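(* Let $\bar A=(A_0,A_1)$ be a compatible couple of (quasi-)Banach spaces with $A_0\cap A_1\neq\{0\}$. Let $0<\theta_0<\theta_1<1$, $0<\theta<1$, $0<r,r_0,r_1,q_0,q_1\le\infty$, $a,a_0,a_1,b_0,b_1\in SV$, $\left\|s^{-1/r_0}\frac{b_0(s)}{a_0(s)}\right\|_{r_0,(0,1)}<\infty$, and $\left\|s^{-1/r_1}\frac{b_1(s)}{a_1(s)}\right\|_{r_1,(1,\infty)}<\infty$. Put $c_0(t)=a_0(t)\left\|s^{-1/r_0}\frac{b_0(s)}{a_0(s)}\right\|_{r_0,(0,t)}$, $c_1(t)=a_1(t)\left\|s^{-1/r_1}\frac{b_1(s)}{a_1(s)}\right\|_{r_1,(t,\infty)}$, and $\rho(t)=t^{\theta_1-\theta_0}\frac{c_0(t)}{c_1(t)}$ for $t>0$. Then $$\left(\bar A^{\mathcal R}_{\theta_0,r_0,b_0,q_0,a_0},\bar A^{\mathcal L}_{\theta_1,r_1,b_1,q_1,a_1}\right)_{\theta,r,a}\cong\bar A_{\eta,r,a^{\#}},$$ where $\eta=(1-\theta)\theta_0+\theta\theta_1$ and $a^{\#}(t)=c_0(t)^{1-\theta}c_1(t)^{\theta}a(\rho(t))$.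
   Context: For a compatible couple $\bar X=(X_0,X_1)$ of (quasi-)Banach spaces, $f\in X_0+X_1$ and $t>0$, $K(t,f)=K(t,f;\bar X)=\inf\{\|f_0\|_{X_0}+t\|f_1\|_{X_1}: f=f_0+f_1,\ f_i\in X_i\}$. $\|\cdot\|_{q,(c,d)}$ ($0<q\le\infty$) is the usual (quasi-)norm of the Lebesgue space $L_q$ on the interval $(c,d)$ with Lebesgue measure (variable of integration: the displayed variable; $1/\infty=0$). $SV$ is the set of positive Lebesgue measurable functions $b$ on $(0,\infty)$ that are slowly varying: for each $\varepsilon>0$, $t^{\varepsilon}b(t)$ is equivalent to an increasing function and $t^{-\varepsilon}b(t)$ is equivalent to a decreasing function, where two positive functions are equivalent if each is bounded by a constant multiple of the other. For $0\le\theta\le1$, $0<q\le\infty$, $b\in SV$, $\bar X_{\theta,q,b}=(X_0,X_1)_{\theta,q,b}$ is the space of $f\in X_0+X_1$ with $\|f\|=\left\|u^{-\theta-1/q}b(u)K(u,f)\right\|_{q,(0,\infty)}<\infty$. For $0<\sigma<1$, $0<r,q\le\infty$, $a,b\in SV$, $\bar X^{\mathcal L}_{\sigma,r,b,q,a}$ is the space of $f\in X_0+X_1$ with $\|f\|=\left\|t^{-1/r}\frac{b(t)}{a(t)}\left\|u^{-\sigma-1/q}a(u)K(u,f)\right\|_{q,(0,t)}\right\|_{r,(0,\infty)}<\infty$, and $\bar X^{\mathcal R}_{\sigma,r,b,q,a}$ is the space of $f\in X_0+X_1$ with $\|f\|=\left\|t^{-1/r}\frac{b(t)}{a(t)}\left\|u^{-\sigma-1/q}a(u)K(u,f)\right\|_{q,(t,\infty)}\right\|_{r,(0,\infty)}<\infty$.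 $X\cong Y$ means that $X$ and $Y$ are continuously embedded in each other (same space, equivalent quasi-norms). *)

(* Defs.v *)
From HB Require Import structures.
From mathcomp Require Export all_boot all_order all_algebra.
From mathcomp Require Export all_classical all_reals all_analysis.

Set Implicit Arguments.
Unset Strict Implicit.
Unset Printing Implicit Defensive.

Import Order.TTheory GRing.Theory Num.Theory.
Export numFieldNormedType.Exports.

Local Open Scope classical_set_scope.
Local Open Scope ring_scope.
Local Open Scope ereal_scope.

(* The real line with the sigma-algebra of Lebesgue measurable sets (the type
   on which completed_lebesgue_measure is defined). *)
Definition lebesgueR (R : realType) :=
  caratheodory_type (wlength (idfun : R -> R))^*%mu.

(* 1/q as a real number, with 1/oo = 0 *)
Definition invq (R : realType) (q : \bar R) : R := ((fine q)^-1)%R.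

(* The (quasi-)norm of L_q(D), 0 < q <= +oo; g is only used on D. *)
Definition LqOn (R : realType) (q : \bar R) (D : set R) (g : R -> \bar R)
    : \bar R :=
  Lnorm (@completed_lebesgue_measure R) q (g \_ D).

Definition equivalent_on_pos (R : realType) (f g : R -> R) :=
  exists C : R, (0 < C)%R /\
    forall t : R, (0 < t)%R -> (f t <= C * g t)%R /\ (g t <= C * f t)%R.

(* "Increasing" and "decreasing" are understood in the wide sense; up to
   equivalence this makes no difference. *)
Definition slowly_varying (R : realType) (b : R -> R) :=
  [/\ forall t : R, (0 < t)%R -> (0 < b t)%R,
      measurable_fun (`]0%R, +oo[ : set (lebesgueR R)) (b : lebesgueR R -> R) &
      forall eps : R, (0 < eps)%R ->
        (exists g : R -> R,
          [/\ forall t : R, (0 < t)%R -> (0 < g t)%R,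
              forall s t : R, (0 < s)%R -> (s <= t)%R -> (g s <= g t)%R &
              equivalent_on_pos (fun t => t `^ eps * b t)%R g]) /\
        (exists g : R -> R,
          [/\ forall t : R, (0 < t)%R -> (0 < g t)%R,
              forall s t : R, (0 < s)%R -> (s <= t)%R -> (g t <= g s)%R &
              equivalent_on_pos (fun t => t `^ (- eps) * b t)%R g])].

(* [modulus m] says that K is a field of scalars (the reals or the complex
   numbers) and that m is its absolute value, seen as R-valued. It holds for
   K = R with m = Num.norm and for K = R[i] with the usual modulus. *)
Definition modulus (R : realType) (K : numFieldType) (m : K -> R) :=
  exists iota : {rmorphism R -> K},
    {homo iota : x y / (x <= y)%R} /\ forall c : K, (`|c| = iota (m c))%R.

(* A subspace of V with a (quasi-)norm on it is encoded by that quasi-norm,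
   extended by +oo to the whole of V; [carrier N] is the subspace. *)
Definition carrier (R : realType) (V : Type) (N : V -> \bar R) : set V :=
  [set f | N f < +oo].

Definition quasinorm (R : realType) (K : numFieldType) (m : K -> R)
    (V : lmodType K) (N : V -> \bar R) :=
  [/\ forall f, 0 <= N f,
      forall f, N f = 0 <-> f = 0%R,
      forall (c : K) f, N (c *: f)%R = (m c)%:E * N f &
      exists2 C : R, (1 <= C)%R &
        forall f g, N (f + g)%R <= C%:E * (N f + N g)].

Definition complete_quasinorm (R : realType) (V : zmodType) (N : V -> \bar R) :=
  forall u : nat -> V, (forall n, carrier N (u n)) ->
    (forall e : R, (0 < e)%R -> exists n0 : nat, forall i j : nat,
       (n0 <= i)%N -> (n0 <= j)%N -> N (u i - u j)%R < e%:E) ->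
    exists2 f, carrier N f &
      forall e : R, (0 < e)%R -> exists n0 : nat, forall i : nat,
        (n0 <= i)%N -> N (u i - f)%R < e%:E.

(* A quasi-Banach space continuously embedded in V *)
Definition quasi_Banach_in (R : realType) (K : numFieldType) (m : K -> R)
    (V : topologicalLmodType K) (N : V -> \bar R) :=
  [/\ quasinorm m N, complete_quasinorm N &
      forall U : set V, nbhs (0%R : V) U ->
        exists2 e : R, (0 < e)%R & forall f, N f < e%:E -> U f].

Definition compatible_couple (R : realType) (K : numFieldType) (m : K -> R)
    (V : topologicalLmodType K) (N0 N1 : V -> \bar R) :=
  [/\ hausdorff_space V, quasi_Banach_in m N0 & quasi_Banach_in m N1].

Section interpolation.
Context (R : realType) (V : zmodType).
Implicit Types (N M : V -> \bar R) (a b : R -> R) (q r : \bar R).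

(* Peetre's K-functional of the couple (carrier N0, carrier N1); it is +oo when
   f is not in the sum of the two spaces. Hence so are the three quasi-norms
   below, since their weights are positive when a and b are. *)
Definition Kfun N0 N1 (t : R) (f : V) : \bar R :=
  ereal_inf [set N0 g.1 + t%:E * N1 g.2 | g in
    [set g : V * V | [/\ carrier N0 g.1, carrier N1 g.2 & f = (g.1 + g.2)%R]]].

Definition interp (theta : R) q b N0 N1 : V -> \bar R := fun f =>
  LqOn q `]0%R, +oo[
    (fun u => (u `^ (- theta - invq q) * b u)%R%:E * Kfun N0 N1 u f).

Definition interpL (sigma : R) r b q a N0 N1 : V -> \bar R := fun f =>
  LqOn r `]0%R, +oo[
    (fun t => (t `^ (- invq r) * (b t / a t))%R%:E *
       LqOn q `]0%R, t[
         (fun u => (u `^ (- sigma - invq q) * a u)%R%:E * Kfun N0 N1 u f)).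

Definition interpR (sigma : R) r b q a N0 N1 : V -> \bar R := fun f =>
  LqOn r `]0%R, +oo[
    (fun t => (t `^ (- invq r) * (b t / a t))%R%:E *
       LqOn q `]t, +oo[
         (fun u => (u `^ (- sigma - invq q) * a u)%R%:E * Kfun N0 N1 u f)).

Definition cont_embedded N M :=
  carrier N `<=` carrier M /\
  exists2 C : R, (0 < C)%R & forall f, carrier N f -> M f <= C%:E * N f.

Definition space_equiv N M := cont_embedded N M /\ cont_embedded M N.

End interpolation.

(* || s^(-1/r) b(s)/a(s) ||_{r, D} *)
Definition weight_norm (R : realType) (r : \bar R) (b a : R -> R) (D : set R)
    : \bar R :=
  LqOn r D (fun s => (s `^ (- invq r) * (b s / a s))%R%:E).

(* Main.v *)
(** In the variable x = ln t everything becomes additive: b is slowly varying iff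
L = ln o b o exp satisfies |L x - L y| <= c + e |x - y| for every e > 0, and
each quasi-norm is equivalent to an l^q norm over the blocks [e^k, e^(k+1)).
No measurability is needed for this, which matters because a(rho(t)) need not
be measurable when a is only Lebesgue measurable.

Let Y0, Y1 be the R- and L-space. All that is used about them is a pair of
one-sided estimates, for kappa_k(f) = K(e^k, f; A0, A1): from below,
kappa_n(f) c_i(e^n) e^(-theta_i n) <= C |f|_(Y_i); from above,
|f|_(Y_i) <= C B as soon as
kappa_k(f) <= B e^(theta_i k) c_i(e^n)^-1 e^(-eps |k - n|) for all k.
The lower one gives kappa_n(f) <= C e^(theta_0 n) c_0(e^n)^-1
K(rho(e^n), f; Y0, Y1), hence one inclusion. For the other one, f is
decomposed almost optimally for kappa_n, the upper estimate is applied to both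
pieces with B an exponentially damped l^r norm centred at n, and the resulting
convolution is handled by Tonelli's theorem. Since ln rho(e^x) grows at a rate
between (theta_1 - theta_0)/2 and theta_1 - theta_0 + 1, replacing the points
rho(e^n) by the points e^j costs only a constant. *)

Require Import Defs.
From mathcomp Require Import measurable_realfun ess_sup_inf ring lra zify.

Set Implicit Arguments.
Unset Strict Implicit.
Unset Printing Implicit Defensive.

Import Order.TTheory GRing.Theory Num.Theory.

Local Open Scope classical_set_scope.
Local Open Scope ring_scope.
Local Open Scope ereal_scope.

Local Notation eE x := ((expR x)%:E).

(** * Exponential factors in the extended reals *)

Section expE.
Context (R : realType).
Implicit Types (x y z : R) (a b c : \bar R).

Lemma eE_ge0 x : 0 <= eE x. Proof. by rewrite lee_fin expR_ge0. Qed.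

Lemma eE_mul x y a : eE x * (eE y * a) = eE (x + y) * a.
Proof. by rewrite muleA -EFinM -expRD. Qed.

Lemma eE0 a : eE (0 : R) * a = a. Proof. by rewrite expR0 mul1e. Qed.

Lemma eE_le x a b : a <= b -> eE x * a <= eE x * b.
Proof. by move=> ab; rewrite lee_wpmul2l// eE_ge0. Qed.

Lemma eE_homo x y a : 0 <= a -> (x <= y)%R -> eE x * a <= eE y * a.
Proof. by move=> a0 xy; rewrite lee_wpmul2r// lee_fin ler_expR. Qed.

Lemma eE_mul_ge0 x a : 0 <= a -> 0 <= eE x * a.
Proof. by move=> a0; rewrite mule_ge0// eE_ge0. Qed.

Lemma eE_moveL x a b : a <= eE x * b -> eE (- x) * a <= b.
Proof. by move=> /(eE_le (- x)); rewrite eE_mul addNr eE0. Qed.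

Lemma eE_moveR x a b : eE (- x) * a <= b -> a <= eE x * b.
Proof. by move=> /(eE_le x); rewrite eE_mul subrr eE0. Qed.

End expE.

(** * Sequence norms over the integers, geometric sums and a Schur estimate *)

Section lq.
Context (R : realType).
Implicit Types (q : \bar R) (x y u v : int -> \bar R) (r : R).

Definition lq q x : \bar R :=
  match q with
  | r%:E => (\esum_(k in [set: int]) (x k `^ r)) `^ r^-1
  | _ => ereal_sup (range x)
  end.

Lemma lq_ge0 q x : (forall k, 0 <= x k) -> 0 <= lq q x.
Proof.
move=> x0; case: q => [r||] /=; first exact: poweR_ge0.
- by rewrite (le_trans (x0 0%R))//; apply: ereal_sup_ubound; exists 0%R.
- by rewrite (le_trans (x0 0%R))//; apply: ereal_sup_ubound; exists 0%R.
Qed.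

Lemma esum_ub x k : (forall k, 0 <= x k) -> x k <= \esum_(k in [set: int]) x k.
Proof.
move=> x0; apply: esum_ge; exists [set k]; first by split.
by rewrite fsbig_set1.
Qed.

Lemma le_poweR r (a b : \bar R) : (0 <= r)%R -> 0 <= a -> a <= b ->
  a `^ r <= b `^ r.
Proof.
move=> r0 a0 ab; apply: gt0_ler_poweR => //; rewrite in_itv/= leey andbT//.
exact: le_trans ab.
Qed.

Lemma lq_ub q x k : 0 < q -> (forall k, 0 <= x k) -> x k <= lq q x.
Proof.
case: q => [r||]//= r0 x0; last by apply: ereal_sup_ubound; exists k.
rewrite lte_fin in r0.
have -> : x k = (x k `^ r) `^ r^-1.
  by rewrite -poweRrM divff ?poweRe1// gt_eqF.
apply: le_poweR; first by rewrite invr_ge0 ltW.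
  exact: poweR_ge0.
by apply: (esum_ub (x := fun k => x k `^ r)) => i; exact: poweR_ge0.
Qed.

Lemma le_esumZ (c : R) x y : (0 <= c)%R ->
    (forall k, 0 <= y k) -> (forall k, x k <= c%:E * y k) ->
  \esum_(k in [set: int]) x k <= c%:E * \esum_(k in [set: int]) y k.
Proof.
move=> c0 y0 xy; apply: ge_ereal_sup => _ [X [finX _] <-].
apply: (@le_trans _ _ (\sum_(i \in X) c%:E * y i)); first exact: lee_fsum.
rewrite -ge0_mule_fsumr// lee_wpmul2l// ?lee_fin//.
by apply: ereal_sup_ubound; exists X.
Qed.

Lemma eE_powR (c r : R) (a : \bar R) : 0 <= a ->
  (eE c * a) `^ r = eE (c * r) * a `^ r.
Proof.
by move=> a0; rewrite poweRM ?eE_ge0// poweR_EFin expRM.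
Qed.

Lemma le_lq q (c : R) x y : 0 < q -> (forall k, 0 <= x k) ->
    (forall k, 0 <= y k) -> (forall k, x k <= eE c * y k) ->
  lq q x <= eE c * lq q y.
Proof.
case: q => [r||]//= r0 x0 y0 xy; last first.
  apply: ge_ereal_sup => _ [k _ <-]; rewrite (le_trans (xy k))// eE_le//.
  by apply: ereal_sup_ubound; exists k.
rewrite lte_fin in r0.
have S0 : 0 <= \esum_(k in [set: int]) y k `^ r.
  by rewrite esum_ge0// => i _; exact: poweR_ge0.
have -> : eE c * (\esum_(k in [set: int]) y k `^ r) `^ r^-1 =
    (eE (c * r) * (\esum_(k in [set: int]) y k `^ r)) `^ r^-1.
  by rewrite eE_powR// -mulrA divff ?mulr1// gt_eqF.
apply: le_poweR; first by rewrite invr_ge0 ltW.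
  by rewrite esum_ge0// => i _; exact: poweR_ge0.
apply: le_esumZ; first exact: expR_ge0.
  by move=> k; exact: poweR_ge0.
by move=> k; rewrite -eE_powR// le_poweR// ltW.
Qed.

Lemma lq_reindex q x (e : int -> int) : bijective e ->
  lq q (fun k => x (e k)) = lq q x.
Proof.
move=> be; have sbe : set_bij [set: int] [set: int] e by rewrite setTT_bijective.
have rx : range (fun k => x (e k)) = range x.
  apply/seteqP; split=> [_ [k _ <-]|_ [k _ <-]]; first by exists (e k).
  by case: be => g eg ge; exists (g k) => //; rewrite ge.
case: q => [r||]/=; [|by rewrite rx..].
by rewrite (@reindex_esum R _ _ _ _ e (fun k => x k `^ r) sbe).
Qed.

Lemma lq_shift q x (n : int) : lq q (fun k => x (k + n)%R) = lq q x.
Proof.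
apply: (@lq_reindex q x (fun k => k + n)%R).
by exists (fun k => k - n)%R => k; rewrite ?addrK ?subrK.
Qed.

(** The factor bounds 2^(1/q): the q-th powers sum to at most 2 M^q, and 2 <= e. Working with powers
    avoids the triangle inequality, so q < 1 is covered. *)
Lemma lq_split q x u v M : 0 < q -> (forall k, 0 <= x k) ->
    (forall k, 0 <= u k) -> (forall k, 0 <= v k) ->
    (forall k, x k <= u k \/ x k <= v k) ->
    lq q u <= M -> lq q v <= M ->
  lq q x <= eE (invq q) * M.
Proof.
case: q => [r||]//= r0 x0 u0 v0 xuv uM vM; last first.
  (* For [q = +oo], [fine q] is 0 and [0^-1 = 0], so the factor is 1. *)
  rewrite /invq invr0 eE0; apply: ge_ereal_sup => _ [k _ <-].
  by case: (xuv k) => /le_trans; apply; [apply: le_trans uM|apply: le_trans vM];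
    apply: ereal_sup_ubound; exists k.
rewrite lte_fin in r0; rewrite /invq/=.
have p0 (z : int -> \bar R) : 0 <= \esum_(k in [set: int]) z k `^ r.
  by rewrite esum_ge0// => i _; exact: poweR_ge0.
have M0 : 0 <= M by apply: le_trans uM; exact: poweR_ge0.
have pM (z : int -> \bar R) : (\esum_(k in [set: int]) z k `^ r) `^ r^-1 <= M ->
    \esum_(k in [set: int]) z k `^ r <= M `^ r.
  move=> zM; have /le_poweR : 0 <= (\esum_(k in [set: int]) z k `^ r) `^ r^-1.
    exact: poweR_ge0.
  by move=> /(_ r _ (ltW r0) zM); rewrite -poweRrM mulVf ?gt_eqF// poweRe1.
have -> : eE r^-1 * M = (eE 1 * M `^ r) `^ r^-1.
  by rewrite eE_powR ?poweR_ge0// mul1r -poweRrM divff ?gt_eqF// poweRe1.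
apply: le_poweR => //; first by rewrite invr_ge0 ltW.
apply: (@le_trans _ _ (\esum_(k in [set: int]) (u k `^ r + v k `^ r))).
  apply: le_esum => k _; case: (xuv k) => h.
    by apply: (le_trans (le_poweR (ltW r0) (x0 k) h)); rewrite leeDl ?poweR_ge0.
  by apply: (le_trans (le_poweR (ltW r0) (x0 k) h)); rewrite leeDr ?poweR_ge0.
rewrite esumD; [|by move=> *; exact: poweR_ge0..].
apply: (le_trans (leeD (pM u uM) (pM v vM))).
rewrite -mule2n -mule_natl lee_wpmul2r ?poweR_ge0// lee_fin.
by rewrite (le_trans _ (expR_ge1Dx _)).
Qed.

Lemma esum_int x : (forall k, 0 <= x k) ->
  \esum_(k in [set: int]) x k =
  \sum_(i <oo) x (Posz i) + \sum_(i <oo) x (Negz i).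
Proof.
move=> x0.
rewrite (esumID (range Posz)); last by [].
congr (_ + _).
  rewrite setTI nneseries_esumT// (@reindex_esum _ _ _ [set: nat] _ Posz)//.
  by split=> [i _|i j _ _ []|i [j _ <-]]//; exists j.
rewrite setTI nneseries_esumT// (@reindex_esum _ _ _ [set: nat] _ Negz)//.
split=> [i _ [j _]//|i j _ _ []//|[i|i] h]; last by exists i.
by exfalso; apply: h; exists i.
Qed.

(** Each of the halves k >= 0 and k < 0 is dominated by the geometric series of ratio z = e^(-e),
    whence the bound 2 / (1 - z). *)
Lemma geom_fin (e : R) : (0 < e)%R ->
  exists c : R, \esum_(k in [set: int]) eE (- e * `|k%:~R|) <= eE c.
Proof.
move=> e0; pose z := expR (- e).
have z0 : (0 < z)%R by exact: expR_gt0.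
have z1 : (z < 1)%R by rewrite expR_lt1 oppr_lt0.
have gz : limn (fun n => \sum_(0 <= i < n) (z ^+ i)%:E) <= (1 - z)^-1%:E.
  apply: lime_le; first by apply: is_cvg_nneseries => *; rewrite lee_fin exprn_ge0 ?ltW.
  apply: nearW => n; rewrite sumEFin lee_fin.
  rewrite -(@ler_pM2r _ (1 - z)) ?subr_gt0// mulVf ?gt_eqF ?subr_gt0//.
  have -> : ((\sum_(0 <= i < n) z ^+ i) * (1 - z) = 1 - z ^+ n)%R.
    elim: n => [|n IH]; first by rewrite big_nil expr0 mul0r subrr.
    by rewrite big_nat_recr//= mulrDl IH exprS; ring.
  by rewrite lerBlDr lerDl exprn_ge0// ltW.
exists (ln (2 * (1 - z)^-1)).
have h1 : (0 < (1 - z)^-1)%R by rewrite invr_gt0 subr_gt0.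
rewrite lnK; last by rewrite posrE mulr_gt0.
rewrite esum_int; last by move=> k; exact: eE_ge0.
rewrite mulr_natl mulr2n EFinD leeD//.
  apply: le_trans gz; apply: lee_nneseries => [i _ _|i _]; first exact: eE_ge0.
  rewrite lee_fin /z -expRM_natr ler_expR.
  by rewrite -pmulrn ger0_norm// mulr_natr.
apply: le_trans gz; apply: lee_nneseries => [i _ _|i _]; first exact: eE_ge0.
rewrite lee_fin /z -expRM_natr ler_expR NegzE.
rewrite mulrNz normrN -pmulrn ger0_norm//.
by rewrite ler_nM2l ?oppr_lt0// ler_nat.
Qed.

Lemma lq_geom q (e : R) : 0 < q -> (0 < e)%R ->
  exists c : R, forall n : int,
    lq q (fun k => eE (- e * `|(n - k)%:~R|)) <= eE c.
Proof.
move=> q0 e0.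
suff [c hc] : exists c : R, lq q (fun k => eE (- e * `|k%:~R|)) <= eE c.
  exists c => n; rewrite -(@lq_reindex q _ (fun k => n - k)%R) in hc => //.
  by exists (fun k => n - k)%R => k; ring.
case: q q0 => [r||]//= r0.
  rewrite lte_fin in r0.
  have [c hc] := geom_fin (mulr_gt0 e0 r0).
  exists (c * r^-1)%R; rewrite expRM -poweR_EFin.
  apply: le_poweR; first by rewrite invr_ge0 ltW.
    by rewrite esum_ge0// => i _; exact: poweR_ge0.
  apply: le_trans hc; apply: le_esum => k _; rewrite /= -expRM.
  by rewrite lee_fin ler_expR; lra.
exists 0%R; apply: ge_ereal_sup => _ [k _ <-].
by rewrite lee_fin ler_expR mulNr oppr_le0 mulr_ge0// ltW.
Qed.

Lemma esum_swap (x : int -> int -> \bar R) : (forall i j, 0 <= x i j) ->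
  \esum_(i in [set: int]) \esum_(j in [set: int]) x i j =
  \esum_(j in [set: int]) \esum_(i in [set: int]) x i j.
Proof.
move=> x0; rewrite !esum_esum//.
rewrite (@reindex_esum R _ _ ([set: int] `*`` (fun=> [set: int])) _
  (fun k : int * int => (k.2, k.1)) (fun k => x k.1 k.2))//.
by split=> [//|[i1 i2] [j1 j2] _ _ [-> ->]//|[i j] _]; exists (j, i).
Qed.

(** Seen from a point [p n0] that is nearest to [t] up to 1, the other points recede at least
    linearly, so the sum is dominated by a geometric one centred at [n0], uniformly in [t]. *)
Lemma sparse_geom (p : int -> R) (d c e : R) : (0 < d)%R -> (0 < e)%R ->
    (forall m n, d * `|(m - n)%:~R| - c <= `|p m - p n|)%R ->
  exists C : R, forall t : R,
    \esum_(n in [set: int]) eE (- e * `|p n - t|) <= eE C.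
Proof.
move=> d0 e0 hp.
have [C hC] := geom_fin (mulr_gt0 (mulr_gt0 e0 d0) (@ltr0Sn R 0)).
have e20 : (0 < e * (d / 2))%R by nra.
have [C' hC'] := geom_fin e20.
exists (e * (c + 1) / 2 + C')%R => t.
have [n0 hn0] : exists n0, forall n, (`|p n0 - t| <= `|p n - t| + 1)%R.
  pose S := [set `|p n - t|%R | n in [set: int]].
  have infS : has_inf S.
    by split; [exists `|p 0%R - t|%R; exists 0%R|exists 0%R => _ [n _ <-]].
  have [_ [n0 _ <-] h] := inf_adherent ltr01 infS.
  exists n0 => n; apply/ltW/(lt_le_trans h); rewrite lerD2r.
  by apply: ge_inf; [exact: infS.2|exists n].
(* By the triangle inequality [|p n - p n0|] is at most [2 * |p n - t| + 1], which halves the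
   rate. *)
have h n : (e * (d / 2) * `|(n - n0)%:~R| - e * (c + 1) / 2 <= e * `|p n - t|)%R.
  have h1 := hn0 n; have h2 := hp n n0.
  have h3 : (`|p n - p n0| <= `|p n - t| + `|p n0 - t|)%R.
    by rewrite (_ : p n - p n0 = (p n - t) - (p n0 - t))%R ?ler_normB//; ring.
  have h4 : (d / 2 * `|(n - n0)%:~R| - (c + 1) / 2 <= `|p n - t|)%R by lra.
  have := ler_wpM2l (ltW e0) h4; lra.
apply: (@le_trans _ _ (eE (e * (c + 1) / 2) *
   \esum_(n in [set: int]) eE (- (e * (d / 2)) * `|n%:~R|))); last first.
  by rewrite expRD EFinM; apply: eE_le.
rewrite (@reindex_esum R int int [set: int] _ (fun n => n - n0)%R
   (fun n => eE (- (e * (d / 2)) * `|n%:~R|))); last first.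
  rewrite setTT_bijective; exists (fun n => n + n0)%R => k; rewrite ?addrK ?subrK//.
apply: le_esumZ => [|k|k]; [exact: expR_ge0|exact: eE_ge0|].
rewrite -EFinM -expRD lee_fin ler_expR; have := h k; lra.
Qed.

(** For finite q the q-th power of the left side is a double sum; Tonelli puts the sum over [n]
    inside, where [sparse_geom] bounds it uniformly in [j]. No convexity enters, so q < 1 is
    allowed. *)
Lemma lq_schur q (p : int -> R) (d c e : R) : 0 < q -> (0 < d)%R -> (0 < e)%R ->
    (forall m n, d * `|(m - n)%:~R| - c <= `|p m - p n|)%R ->
  exists C : R, forall y, (forall k, 0 <= y k) ->
    lq q (fun n => lq q (fun j => eE (- e * `|p n - j%:~R|) * y j)) <=
    eE C * lq q y.
Proof.
case: q => [r||]//= q0 d0 e0 hp; last first.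
  exists 0%R => y y0; rewrite eE0; apply: ge_ereal_sup => _ [n _ <-].
  apply: ge_ereal_sup => _ [j _ <-]; apply: (@le_trans _ _ (eE 0 * y j)).
    by rewrite eE_homo// mulNr oppr_le0 mulr_ge0// ltW.
  by rewrite eE0; apply: ereal_sup_ubound; exists j.
rewrite lte_fin in q0.
have [C hC] := sparse_geom d0 (mulr_gt0 e0 q0) hp.
exists (C * r^-1)%R => y y0.
have k0 i j : 0 <= (eE (- e * `|p i - j%:~R|) * y j) `^ r by exact: poweR_ge0.
have S0 : 0 <= \esum_(k in [set: int]) y k `^ r.
  by apply: esum_ge0 => *; exact: poweR_ge0.
rewrite -eE_powR//; apply: le_poweR; first by rewrite invr_ge0 ltW.
  by apply: esum_ge0 => *; exact: poweR_ge0.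
under eq_esum => n _.
  rewrite -poweRrM mulVf ?gt_eqF// poweRe1; last by apply: esum_ge0 => *.
  over.
rewrite esum_swap//; apply: le_esumZ; first exact: expR_ge0.
  by move=> k; exact: poweR_ge0.
move=> j /=; rewrite muleC.
apply: (@le_trans _ _ (y j `^ r * \esum_(i in [set: int])
    eE (- (e * r) * `|p i - j%:~R|))); last by rewrite lee_wpmul2l ?poweR_ge0.
have -> : \esum_(i in [set: int]) (eE (- e * `|p i - j%:~R|) * y j) `^ r =
   \esum_(i in [set: int]) (y j `^ r * eE (- (e * r) * `|p i - j%:~R|)).
  apply: eq_esum => i _; rewrite eE_powR// muleC; congr (_ * eE _); ring.
have := poweR_ge0 (y j) r; case: (y j `^ r) => [s|_|//].
  by rewrite lee_fin => s0; apply: le_esumZ => // i; rewrite eE_ge0.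
(* An infinite power of [y j] makes the right side infinite, because the kernel sum is positive. *)
rewrite gt0_mulye ?leey//.
apply: lt_le_trans (esum_ub (x := fun i => eE (- (e * r) * `|p i - j%:~R|)) 0%R _).
  by rewrite lte_fin expR_gt0.
by move=> k; exact: eE_ge0.
Qed.

End lq.

(** * Integral norms against sequence norms over exponential blocks *)

Section blocks.
Context (R : realType).
Local Notation mu := (@completed_lebesgue_measure R).

(* No measurability: the integral is a supremum over simple functions. *)
Lemma le_integral_ge0 (f g : lebesgueR R -> \bar R) :
  (forall t, 0 <= f t) -> (forall t, f t <= g t) ->
  \int[mu]_t f t <= \int[mu]_t g t.
Proof.
move=> f0 fg; have g0 t : 0 <= g t by exact: le_trans (f0 t) (fg t).
rewrite !ge0_integralTE//; apply: le_ereal_sup => _ [h hf <-].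
by exists h => // t; exact: le_trans (hf t) (fg t).
Qed.

Definition block (k : int) : set (lebesgueR R) := `[expR k%:~R, expR (k + 1)%:~R[.

Lemma blockP (k : int) (t : R) :
  block k t <-> (0 < t)%R /\ Num.floor (ln t) = k.
Proof.
rewrite /block/= in_itv/=; split=> [/andP[h1 h2]|[t0 <-]].
  have t0 : (0 < t)%R by rewrite (lt_le_trans _ h1)// expR_gt0.
  split=> //; apply/floor_def; rewrite -(ler_expR k%:~R) -(ltr_expR (ln t)).
  by rewrite lnK ?posrE// h1.
have /andP[h1 h2] := floor_itv (ln t).
by rewrite -[X in (_ <= X < _)%R](lnK (x := t))// ler_expR ltr_expR h1.
Qed.

Lemma block_trivIset : trivIset [set: int] block.
Proof.
apply/trivIsetP => i j _ _ ij; apply/seteqP; split=> // t [/blockP[_ hi] /blockP[_ hj]].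
by move: ij; rewrite -hi -hj eqxx.
Qed.

Lemma measurable_block k : measurable (block k).
Proof. apply: sub_caratheodory; exact: measurable_itv. Qed.

Lemma block_measure k :
  mu (block k) = eE (k%:~R : R) * (expR 1 - 1)%:E.
Proof.
transitivity (@lebesgue_measure R (block k)); first by [].
rewrite lebesgue_measure_itv/= lte_fin ltr_expR ltr_int ltzD1 lexx.
by rewrite intrD expRD -EFinB -EFinM; congr _%:E; ring.
Qed.

Definition step (v : int -> \bar R) (t : lebesgueR R) : \bar R :=
  if (0 < t)%R then v (Num.floor (ln t)) else 0.

Lemma step_ge0 v t : (forall k, 0 <= v k) -> 0 <= step v t.
Proof. by move=> v0; rewrite /step; case: ifP. Qed.

Lemma stepE v k t : block k t -> step v t = v k.
Proof. by move=> /blockP[t0 <-]; rewrite /step t0. Qed.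

Lemma measurable_step_blocks v (e : nat -> int) :
  measurable_fun (\bigcup_n block (e n)) (step v).
Proof.
apply/measurable_fun_bigcup => [i|i]; first exact: measurable_block.
apply: (eq_measurable_fun (cst (v (e i)))) => [t|].
  by rewrite inE => /stepE ->.
exact: measurable_cst.
Qed.

Lemma integral_step_blocks v (e : nat -> int) : (forall k, 0 <= v k) ->
    injective e ->
  \int[mu]_(t in \bigcup_n block (e n)) step v t =
  \sum_(n <oo) v (e n) * mu (block (e n)).
Proof.
move=> v0 ei; rewrite ge0_integral_bigcup.
- apply: eq_eseriesr => n _; rewrite -integral_cst; last exact: measurable_block.
  by apply: eq_integral => t; rewrite inE => /stepE ->.
- by move=> k; exact: measurable_block.
- exact: measurable_step_blocks.
- by move=> t _; exact: step_ge0.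
- apply/trivIsetP => i j _ _ ij; have /trivIsetP := block_trivIset.
  by apply => //; apply: contra_neq ij => /ei.
Qed.

(** Blocks of nonnegative and of negative index form two countable unions indexed by [nat]; off both
    of them the step function vanishes. *)
Lemma integral_step v : (forall k, 0 <= v k) ->
  \int[mu]_t step v t = \esum_(k in [set: int]) (v k * mu (block k)).
Proof.
move=> v0; pose D1 := \bigcup_n block (Posz n); pose D2 := \bigcup_n block (Negz n).
have mD1 : measurable D1 by apply: bigcupT_measurable => i; exact: measurable_block.
have mD2 : measurable D2 by apply: bigcupT_measurable => i; exact: measurable_block.
rewrite esum_int; last by move=> k; rewrite mule_ge0.
transitivity (\int[mu]_(t in D1) step v t + \int[mu]_(t in D2) step v t); last first.
  congr (_ + _); first by apply: (integral_step_blocks (e := Posz)) => // i j [].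
  by apply: (integral_step_blocks (e := Negz)) => // i j [].
rewrite -ge0_integral_setU//; last 3 first.
- by apply/measurable_funU => //; split; exact: measurable_step_blocks.
- by move=> t _; exact: step_ge0.
- apply/disj_setPS => t [[i _ /blockP[_ hi]] [j _ /blockP[_ ]]].
  by rewrite hi.
rewrite [RHS]integral_mkcond; apply: eq_integral => t _; rewrite patchE.
case: ifPn => // /negP; rewrite inE => h; rewrite /step; case: ifPn => // t0.
exfalso; apply: h; case E : (Num.floor (ln t)) => [n|n].
  by left; exists n => //; apply/blockP.
by right; exists n => //; apply/blockP.
Qed.

Lemma mu_setT_gt0 : 0 < mu [set: lebesgueR R].
Proof.
apply: (@lt_le_trans _ _ (mu (block 0))).
  by rewrite block_measure -EFinM lte_fin mulr_gt0 ?expR_gt0// subr_gt0 expR_gt1.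
by apply: le_measure; rewrite ?inE//; exact: measurable_block.
Qed.

Lemma expR1_sub1_bounds : (expR (- 1) <= 1 - expR (- 1) :> R)%R /\
  (expR 1 - 1 <= expR 1 :> R)%R /\ (1 <= expR 1 - 1 :> R)%R.
Proof.
have h := expR_ge1Dx (1 : R).
have h2 : (expR (-1) * expR 1 = 1 :> R)%R by rewrite -expRD addNr expR0.
have h3 := expR_gt0 (-1 : R).
by split; [nra|split; lra].
Qed.

(** On block k the q-th power of t^(-1/q) is at most e^(-k), and the block has measure e^k (e - 1)
    <= e^(k+1); the surplus e becomes e^(1/q). Only a step function is integrated explicitly, so [G]
    may be non-measurable. *)
Lemma Lnorm_le_lq (q : \bar R) (G : R -> \bar R) (x : int -> \bar R) : 0 < q ->
    (forall t, 0 <= G t) -> (forall t, (t <= 0)%R -> G t = 0) ->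
    (forall k, 0 <= x k) ->
    (forall t, (0 < t)%R ->
       G t <= eE (- invq q * ln t) * x (Num.floor (ln t))) ->
  Lnorm mu q G <= eE (`|invq q|) * lq q x.
Proof.
case: q => [r||]// q0 G0 Gn x0 Gx; rewrite unlock/=; last first.
  rewrite mu_setT_gt0 /invq/= invr0 normr0 eE0; apply/ess_supP/nearW => t /=.
  rewrite gee0_abs//; case: (leP t 0%R) => [/Gn ->|t0].
    by rewrite (le_trans (x0 0%R))//; apply: ereal_sup_ubound; exists 0%R.
  rewrite (le_trans (Gx t t0))// /invq/= invr0 oppr0 mul0r eE0.
  by apply: ereal_sup_ubound; exists (Num.floor (ln t)).
rewrite lte_fin in q0; rewrite /invq/=.
have -> : (`|r^-1| = 1 * r^-1)%R by rewrite mul1r ger0_norm// invr_ge0 ltW.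
have S0 : 0 <= \esum_(k in [set: int]) x k `^ r.
  by rewrite esum_ge0// => i _; exact: poweR_ge0.
rewrite -eE_powR//; apply: le_poweR; first by rewrite invr_ge0 ltW.
  by apply: integral_ge0 => t _; exact: poweR_ge0.
pose v k := eE (- k%:~R) * x k `^ r.
have v0 k : 0 <= v k by rewrite eE_mul_ge0// poweR_ge0.
apply: (@le_trans _ _ (\int[mu]_t step v t)).
  apply: le_integral_ge0 => t; first exact: poweR_ge0.
  rewrite gee0_abs// /step; case: ltP => [t0|/Gn ->]; last first.
    by rewrite poweR0r// gt_eqF.
  rewrite (le_trans (le_poweR (ltW q0) (G0 t) (Gx t t0)))//.
  rewrite eE_powR// eE_homo ?poweR_ge0// /invq/=.
  have -> : (- r^-1 * ln t * r = - ln t)%R by field; rewrite gt_eqF.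
  by rewrite lerN2 floor_le.
rewrite integral_step//; apply: le_esumZ => [|k|k].
- exact: expR_ge0.
- exact: poweR_ge0.
rewrite block_measure muleA -[v k * _]muleC /v eE_mul subrr eE0 muleC.
by rewrite lee_wpmul2r ?poweR_ge0// lee_fin expR1_sub1_bounds.2.1.
Qed.

(** The converse comparison uses 1/t >= e^(-(k+1)) on block k and e - 1 >= 1 for its measure. *)
Lemma lq_le_Lnorm (q : \bar R) (G : R -> \bar R) (x : int -> \bar R) : 0 < q ->
    (forall t, 0 <= G t) -> (forall k, 0 <= x k) ->
    (forall t, (0 < t)%R ->
       eE (- invq q * ln t) * x (Num.floor (ln t)) <= G t) ->
  lq q x <= eE (`|invq q|) * Lnorm mu q G.
Proof.
case: q => [r||]// q0 G0 x0 Gx; rewrite unlock/=; last first.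
  rewrite mu_setT_gt0 /invq/= invr0 normr0 eE0; apply: ge_ereal_sup => _ [k _ <-].
  have [N [mN N0 hN]] := ess_sup_ge mu (abse \o G).
  (* A block has positive measure, so it is not contained in the null set [N] off which the
     essential supremum is an upper bound. *)
  have [t [bt Nt]] : exists t, block k t /\ ~ N t.
    apply: contrapT => h; have : mu (block k) <= mu N.
      apply: le_measure; rewrite ?inE//; first exact: measurable_block.
      by move=> t bt; apply: contrapT => Nt; apply: h; exists t.
    rewrite N0 block_measure leNgt => /negP; apply.
    by rewrite -EFinM lte_fin mulr_gt0 ?expR_gt0// subr_gt0 expR_gt1.
  have : (abse \o G) t <= ess_sup mu (abse \o G).
    by apply: contrapT => h; apply: Nt; apply: hN.
  apply: le_trans => /=; rewrite gee0_abs//; have /blockP[t0 <-] := bt.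
  by have := Gx t t0; rewrite /invq/= invr0 oppr0 mul0r eE0.
rewrite lte_fin in q0; rewrite /invq/=.
have -> : (`|r^-1| = 1 * r^-1)%R by rewrite mul1r ger0_norm// invr_ge0 ltW.
have S0 : 0 <= \int[mu]_t (`|G t| `^ r) by apply: integral_ge0 => t _; exact: poweR_ge0.
rewrite -eE_powR//; apply: le_poweR; first by rewrite invr_ge0 ltW.
  by apply: esum_ge0 => t _; exact: poweR_ge0.
pose v k := eE (- (k%:~R + 1)) * x k `^ r.
have v0 k : 0 <= v k by rewrite eE_mul_ge0// poweR_ge0.
apply: (@le_trans _ _ (eE 1 * \int[mu]_t step v t)); last first.
  apply: eE_le; apply: le_integral_ge0 => t; first exact: step_ge0.
  rewrite gee0_abs// /step; case: ltP => [t0|_]; last exact: poweR_ge0.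
  apply: le_trans (le_poweR (ltW q0) _ (Gx t t0)); last exact: eE_mul_ge0.
  rewrite eE_powR// eE_homo ?poweR_ge0// /invq/=.
  have -> : (- r^-1 * ln t * r = - ln t)%R by field; rewrite gt_eqF.
  by have := floorD1_gt (ln t); rewrite intrD lerN2 => /ltW.
rewrite integral_step//; apply: le_esumZ => [|k|k].
- exact: expR_ge0.
- by rewrite mule_ge0.
rewrite block_measure /v -muleA [x k `^ r * _]muleCA !eE_mul.
have -> : (1 + - (k%:~R + 1) + k%:~R = 0 :> R)%R by ring.
by rewrite eE0 lee_pemulr ?poweR_ge0// lee_fin expR1_sub1_bounds.2.2.
Qed.

End blocks.

(** * Slow variation in the logarithmic variable *)

Definition lg (R : realType) (b : R -> R) (x : R) : R := ln (b (expR x)).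

(** A Lipschitz condition at large scale only: the additive constant leaves room for jumps. *)
Definition coarse_lip (R : realType) (M : R) (P : R -> R) :=
  exists c : R, forall x y, (`|P x - P y| <= c + M * `|x - y|)%R.

Definition sv (R : realType) (L : R -> R) :=
  forall e : R, (0 < e)%R -> coarse_lip e L.

Section slow_variation.
Context (R : realType).
Implicit Types (b L P : R -> R) (e M : R).

Lemma lgE b t : (0 < t)%R -> (0 < b t)%R -> b t = expR (lg b (ln t)).
Proof. by move=> t0 b0; rewrite /lg lnK ?posrE// lnK ?posrE. Qed.

(** For x <= y, the almost increasing function t^e b(t) bounds ln b(e^x) - ln b(e^y) from above, and
    the almost decreasing t^(-e) b(t) bounds the opposite difference. Each equivalence is used at
    both ends, hence the factors 2. *)
Lemma sv_lg b : slowly_varying b -> sv (lg b).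
Proof.
move=> [b0 _ bsv] e e0.
have [[g [g0 gm [C [C0 gb]]]] [h [h0 hm [C' [C'0 hb]]]]] := bsv e e0.
have H x y : (x <= y)%R -> (lg b x - lg b y <= 2 * ln C + e * (y - x) /\
    lg b y - lg b x <= 2 * ln C' + e * (y - x))%R.
  move=> xy.
  have ex := expR_gt0 x; have ey := expR_gt0 y.
  have exy : (expR x <= expR y)%R by rewrite ler_expR.
  have bE z : b (expR z) = expR (lg b z) by rewrite /lg lnK ?posrE ?b0 ?expR_gt0.
  have CE : C = expR (ln C) by rewrite lnK.
  have C'E : C' = expR (ln C') by rewrite lnK.
  split.
    have := gm _ _ ex exy; have [+ _] := gb _ ex; have [_ +] := gb _ ey.
    rewrite !bE -!expRM => h1 h2 h3.
    have : (expR (x * e) * expR (lg b x) <= C * (C * (expR (y * e) * expR (lg b y))))%R.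
      apply: (le_trans h2); rewrite ler_pM2l//; exact: le_trans h1.
    by rewrite CE expRK -!expRD ler_expR; clear; lra.
  have := hm _ _ ex exy; have [_ +] := hb _ ex; have [+ _] := hb _ ey.
  rewrite !bE -!expRM => h1 h2 h3.
  have : (expR (y * - e) * expR (lg b y) <= C' * (C' * (expR (x * - e) * expR (lg b x))))%R.
    apply: (le_trans h1); rewrite ler_pM2l//; exact: le_trans h2.
  by rewrite C'E expRK -!expRD ler_expR; clear; lra.
exists (2 * `|ln C| + 2 * `|ln C'|)%R => x y.
have n1 := ler_norm (ln C); have n2 := ler_norm (ln C').
have n3 := normr_ge0 (ln C); have n4 := normr_ge0 (ln C').
rewrite ler_norml; case: (leP x y) => [xy|/ltW xy].
  have -> : (`|x - y| = y - x)%R by rewrite distrC ger0_norm ?subr_ge0.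
  by have [? ?] := H _ _ xy; apply/andP; split; lra.
have -> : (`|x - y| = x - y)%R by rewrite ger0_norm ?subr_ge0.
by have [? ?] := H _ _ xy; apply/andP; split; lra.
Qed.

Lemma coarse_lipD M M' P L : coarse_lip M P -> coarse_lip M' L ->
  coarse_lip (M + M') (fun x => P x + L x)%R.
Proof.
move=> [c hc] [c' hc']; exists (c + c')%R => x y.
have -> : (P x + L x - (P y + L y) = (P x - P y) + (L x - L y))%R by ring.
by rewrite (le_trans (ler_normD _ _))//; have := hc x y; have := hc' x y; lra.
Qed.

Lemma svD L P : sv L -> sv P -> sv (fun x => L x + P x)%R.
Proof.
move=> sL sP e e0; rewrite [e]splitr.
by apply: coarse_lipD; [apply: sL|apply: sP]; rewrite divr_gt0.
Qed.

Lemma svZ (k : R) L : sv L -> sv (fun x => k * L x)%R.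
Proof.
(* The [+ 1] keeps the divisor positive when [k = 0]. *)
move=> sL e e0; have k0 : (0 < `|k| + 1)%R by rewrite ltr_pwDr.
have [c hc] := sL (e / (`|k| + 1))%R (divr_gt0 e0 k0).
exists (`|k| * c)%R => x y; rewrite -mulrBr normrM.
apply: (le_trans (ler_wpM2l (normr_ge0 k) (hc x y))).
rewrite mulrDr lerD2l mulrA ler_wpM2r//.
by rewrite mulrA ler_pdivrMr// mulrC ler_pM2l// lerDl.
Qed.

Lemma sv_comp M L P : sv L -> coarse_lip M P -> sv (fun x => L (P x)).
Proof.
move=> sL [c' hc'] e e0; have k0 : (0 < `|M| + 1)%R by rewrite ltr_pwDr.
have [c hc] := sL (e / (`|M| + 1))%R (divr_gt0 e0 k0).
have d0 := divr_gt0 e0 k0.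
exists (c + e / (`|M| + 1) * c')%R => x y.
apply: (le_trans (hc _ _)); rewrite -addrA lerD2l.
apply: (le_trans (ler_wpM2l (ltW d0) (hc' x y))); rewrite mulrDr lerD2l.
rewrite mulrA ler_wpM2r//; set d := (e / _)%R in d0 *.
have -> : e = (d * (`|M| + 1))%R by rewrite /d divfK// gt_eqF.
by rewrite ler_pM2l//; have := ler_norm M; lra.
Qed.

Lemma coarse_lip_ge0 M P c :
  (forall x y, (`|P x - P y| <= c + M * `|x - y|)%R) -> (0 <= c)%R.
Proof. by move=> /(_ 0%R 0%R); rewrite !subrr normr0 mulr0 addr0. Qed.

End slow_variation.

(** * Dependence of the K-functional on its parameter *)

Section Kfun.
Context (R : realType) (V : zmodType) (N0 N1 : V -> \bar R).
Hypotheses (N0ge0 : forall f, 0 <= N0 f) (N1ge0 : forall f, 0 <= N1 f).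

Lemma Kfun_ge0 (t : R) f : (0 <= t)%R -> 0 <= Kfun N0 N1 t f.
Proof.
move=> t0; apply: le_ereal_inf_tmp => _ [g _ <-].
by rewrite adde_ge0// mule_ge0.
Qed.

Lemma Kfun_le (t : R) f0 f1 : carrier N0 f0 -> carrier N1 f1 ->
  Kfun N0 N1 t (f0 + f1)%R <= N0 f0 + t%:E * N1 f1.
Proof. by move=> h0 h1; apply: ereal_inf_lbound; exists (f0, f1). Qed.

Lemma Kfun_homo (s t : R) f : (0 <= s)%R -> (s <= t)%R ->
  Kfun N0 N1 s f <= Kfun N0 N1 t f.
Proof.
move=> s0 st; apply: le_ereal_inf_tmp => _ [g [g0 g1 ->] <-].
by apply: (le_trans (Kfun_le s g0 g1)); rewrite leeD2l// lee_wpmul2r.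
Qed.

(** This says that K(t)/t is nonincreasing; it holds for the cost of each single decomposition. *)
Lemma Kfun_quot x y f : (x <= y)%R ->
  Kfun N0 N1 (expR y) f <= eE (y - x) * Kfun N0 N1 (expR x) f.
Proof.
move=> xy; apply: eE_moveR; apply: le_ereal_inf_tmp => _ [g [g0 g1 ->] <-].
apply: (le_trans (eE_le _ (Kfun_le (expR y) g0 g1))).
rewrite ge0_muleDr ?mule_ge0 ?eE_ge0// eE_mul.
have -> : (- (y - x) + y = x)%R by ring.
rewrite leeD2r// -[leRHS]eE0; apply: eE_homo => //; lra.
Qed.

(** Monotonicity of K(t) and of K(t)/t together make ln K a 1-Lipschitz function of ln t; the
    product form also covers the values 0 and [+oo]. *)
Lemma Kfun_lip x y f :
  Kfun N0 N1 (expR x) f <= eE `|x - y| * Kfun N0 N1 (expR y) f.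
Proof.
case: (leP x y) => xy.
  have exy : (expR x <= expR y)%R by rewrite ler_expR.
  apply: (le_trans (Kfun_homo f (expR_ge0 x) exy)).
  by rewrite -[leLHS]eE0 eE_homo// Kfun_ge0// expR_ge0.
by rewrite gtr0_norm ?subr_gt0//; apply/Kfun_quot/ltW.
Qed.

End Kfun.

(** * Discretisation of the weighted norms *)

Section discretisation.
Context (R : realType).
Implicit Types (q : \bar R) (D : set R) (g : R -> \bar R) (y : int -> \bar R).

Lemma LqOn_ge0 q D g : 0 <= LqOn q D g.
Proof. exact: Lnorm_ge0. Qed.

Lemma LqOn_le_lq q D g y (c : R) : 0 < q -> (forall k, 0 <= y k) ->
    (forall t, D t -> (0 < t)%R) -> (forall t, D t -> 0 <= g t) ->
    (forall t, D t -> g t <= eE (- invq q * ln t) * (eE c * y (Num.floor (ln t)))) ->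
  LqOn q D g <= eE (c + `|invq q|) * lq q y.
Proof.
move=> q0 y0 D0 g0 gy.
have cy0 k : 0 <= eE c * y k by rewrite eE_mul_ge0.
apply: (@le_trans _ _ (eE `|invq q| * lq q (fun k => eE c * y k))).
  apply: Lnorm_le_lq => // t.
  - by rewrite patchE; case: ifPn => //; rewrite inE => /g0.
  - rewrite patchE; case: ifPn => //; rewrite inE => /D0 t0 tn.
    by move: t0; rewrite ltNge tn.
  - move=> t0; rewrite patchE; case: ifPn; first by rewrite inE => /gy.
    by rewrite eE_mul_ge0.
have h := le_lq (x := fun k => eE c * y k) q0 cy0 y0 (fun k => lexx _).
have -> : eE (c + `|invq q|) * lq q y = eE `|invq q| * (eE c * lq q y).
  by rewrite eE_mul addrC.
exact: eE_le h.
Qed.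

(** A norm over [D] controls only blocks lying entirely in [D], so [y] must vanish on every block
    that leaves [D]. *)
Lemma lq_le_LqOn q D g y (c : R) : 0 < q -> (forall k, 0 <= y k) ->
    (forall t, D t -> 0 <= g t) ->
    (forall t, (0 < t)%R -> ~ D t -> y (Num.floor (ln t)) = 0) ->
    (forall t, (0 < t)%R -> D t ->
       eE (- invq q * ln t) * (eE (- c) * y (Num.floor (ln t))) <= g t) ->
  lq q y <= eE (c + `|invq q|) * LqOn q D g.
Proof.
move=> q0 y0 g0 yD gy.
have cy0 k : 0 <= eE (- c) * y k by rewrite eE_mul_ge0.
apply: (@le_trans _ _ (eE c * lq q (fun k => eE (- c) * y k))).
  by apply: le_lq => // k; rewrite eE_mul subrr eE0.
rewrite -eE_mul; apply: eE_le; apply: lq_le_Lnorm => // t.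
  by rewrite patchE; case: ifPn => //; rewrite inE => /g0.
move=> t0; rewrite patchE; case: ifPn; first by rewrite inE => /gy; apply.
by move=> /negP; rewrite inE => nD; rewrite yD// !mule0.
Qed.

(* The K-functional may be +oo; its real lower bounds can be moved through an
   l^q norm. *)
Lemma le_exp_below (a b : \bar R) : 0 <= b ->
  (forall u : R, eE u <= a -> eE u <= b) -> a <= b.
Proof.
move=> b0 h; case: a h => [x||] h; last by rewrite leNye.
  case: (leP x 0%R) => x0; first by rewrite (le_trans _ b0)// lee_fin.
  by have := h (ln x); rewrite lnK ?posrE//; apply.
case: b b0 h => [r||]// r0 h.
have := h r (leey _); rewrite lee_fin => hr.
by exfalso; move: hr (expR_ge1Dx r); clear; lra.
Qed.

Lemma floor_dist (x : R) : (`|x - (Num.floor x)%:~R| <= 1)%R.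
Proof.
have := floor_itv x; rewrite intrD => /andP[h1 h2].
by rewrite ger0_norm ?subr_ge0//; lra.
Qed.

(** For [L = lg b] this is u^(-theta) b(u) K(u, f) at u = e^x; the remaining factor u^(-1/q) is
    absorbed by the lengths of the blocks. *)
Definition weightedK (V : zmodType) (theta : R) (L : R -> R)
    (N0 N1 : V -> \bar R) (f : V) (x : R) :=
  eE (- theta * x + L x) * Kfun N0 N1 (expR x) f.

Lemma weightedK_ge0 (V : zmodType) (theta : R) (L : R -> R) (N0 N1 : V -> \bar R) f x :
  (forall f, 0 <= N0 f) -> (forall f, 0 <= N1 f) -> 0 <= weightedK theta L N0 N1 f x.
Proof. by move=> h0 h1; rewrite eE_mul_ge0// Kfun_ge0// expR_ge0. Qed.

Lemma weightedK_lip (d theta M : R) (L : R -> R) : coarse_lip M L ->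
  exists c : R, forall (V : zmodType) (N0 N1 : V -> \bar R),
    (forall f, 0 <= N0 f) -> (forall f, 0 <= N1 f) -> forall f (x y : R),
    (`|x - y| <= d)%R ->
    weightedK theta L N0 N1 f x <= eE c * weightedK theta L N0 N1 f y.
Proof.
move=> [c hc]; exists (`|theta| * d + c + `|M| * d + d)%R => V N0 N1 h0 h1 f x y xy.
rewrite /weightedK; apply: (le_trans (eE_le _ (Kfun_lip h0 h1 x y f))).
rewrite !eE_mul; apply: eE_homo; first exact: Kfun_ge0 (expR_ge0 _).
have h2 := hc x y; have h3 : (M * `|x - y| <= `|M| * d)%R.
  by rewrite (le_trans (ler_norm _))// normrM normr_id ler_wpM2l.
have h4 : (- theta * (x - y) <= `|theta| * d)%R.
  by rewrite (le_trans (ler_norm _))// normrM normrN ler_wpM2l.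
have := ler_norm (L x - L y)%R; lra.
Qed.

Lemma weightE (q : \bar R) (theta : R) (b : R -> R) (t : R) (a : \bar R) :
  (0 < t)%R -> (0 < b t)%R ->
  (t `^ (- theta - invq q) * b t)%R%:E * a =
  eE (- invq q * ln t) * (eE (- theta * ln t + lg b (ln t)) * a).
Proof.
move=> t0 b0; rewrite eE_mul {1}(lgE t0 b0) /powR gt_eqF// -expRD.
by congr (eE _ * _); ring.
Qed.

(** Within a block the weighted K-functional varies by a bounded factor. [N0] and [N1] are merely
    nonnegative, so the result applies to the couple of the R- and L-spaces without showing that
    these are quasi-normed. *)
Lemma interp_discrete (theta M : R) q (b : R -> R) : 0 < q ->
    (forall t, (0 < t)%R -> (0 < b t)%R) -> coarse_lip M (lg b) ->
  exists c : R, forall (V : zmodType) (N0 N1 : V -> \bar R),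
    (forall f, 0 <= N0 f) -> (forall f, 0 <= N1 f) -> forall f,
    let x := fun k : int => weightedK theta (lg b) N0 N1 f k%:~R in
    interp theta q b N0 N1 f <= eE c * lq q x /\
    lq q x <= eE c * interp theta q b N0 N1 f.
Proof.
move=> q0 b0 lb; have [c hc] := weightedK_lip 1 theta lb.
exists (c + `|invq q|)%R => V N0 N1 h0 h1 f /=.
have x0 (y : R) : 0 <= weightedK theta (lg b) N0 N1 f y.
  by rewrite eE_mul_ge0//; exact: Kfun_ge0 (expR_ge0 _).
have g0 t : `]0%R, +oo[%classic t ->
    0 <= (t `^ (- theta - invq q) * b t)%R%:E * Kfun N0 N1 t f.
  rewrite /= in_itv/= andbT => t0; rewrite mule_ge0 ?lee_fin ?mulr_ge0 ?powR_ge0//.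
    exact/ltW/b0.
  exact: Kfun_ge0 (ltW t0).
split.
  apply: LqOn_le_lq => // t; rewrite /= in_itv/= andbT// => t0.
  rewrite weightE ?b0//; apply: eE_le.
  have := hc _ _ _ h0 h1 f _ _ (floor_dist (ln t)).
  by rewrite {1}/weightedK lnK.
apply: lq_le_LqOn => // t; rewrite /= in_itv/= andbT// => t0 _.
rewrite weightE ?b0//; apply: eE_le; apply: eE_moveL.
have := floor_dist (ln t); rewrite distrC => /(hc _ _ _ h0 h1 f).
by rewrite {2}/weightedK lnK.
Qed.

End discretisation.

(** * A common description of the two one-sided norms *)

Section one_sided.
Context (R : realType).

Definition ray (s : bool) (t : R) : set R :=
  if s then `]t, +oo[%classic else `]0%R, t[%classic.

(** Block [k] can meet the ray starting at a point of block [j]. *)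
Definition ord_to (s : bool) (j k : int) : bool :=
  if s then (j <= k)%R else (k <= j)%R.

(* interpR for s = true and interpL for s = false *)
Definition interpRay (V : zmodType) s (sigma : R) r b q a (N0 N1 : V -> \bar R) :
    V -> \bar R := fun f =>
  LqOn r `]0%R, +oo[
    (fun t => (t `^ (- invq r) * (b t / a t))%R%:E *
       LqOn q (ray s t)
         (fun u => (u `^ (- sigma - invq q) * a u)%R%:E * Kfun N0 N1 u f)).

Lemma ray_gt0 s (t u : R) : (0 < t)%R -> ray s t u -> (0 < u)%R.
Proof.
case: s => t0; rewrite /ray/= in_itv/= ?andbT; first exact: lt_trans.
by case/andP.
Qed.

Lemma ray_ord s (t u : R) : (0 < t)%R -> ray s t u ->
  ord_to s (Num.floor (ln t)) (Num.floor (ln u)).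
Proof.
move=> t0 h; have u0 := ray_gt0 t0 h; move: h.
case: s; rewrite /ray/= in_itv/= ?andbT => h.
  by apply: le_floor; rewrite ler_ln ?posrE// ltW.
by case/andP: h => _ h; apply: le_floor; rewrite ler_ln ?posrE// ltW.
Qed.

(** The block containing [t] is cut by the ray, hence the exclusion of equal indices. *)
Lemma ord_ray s (t u : R) : (0 < t)%R -> (0 < u)%R ->
  ord_to s (Num.floor (ln t)) (Num.floor (ln u)) ->
  Num.floor (ln t) != Num.floor (ln u) -> ray s t u.
Proof.
move=> t0 u0; rewrite /ord_to /ray.
case: s => h1 h2; rewrite /= in_itv/= ?andbT ?u0/= ltNge; apply: contra h2 => h.
  by rewrite eq_le  h1 le_floor// ler_ln ?posrE.
by rewrite eq_le  h1 le_floor// ler_ln ?posrE.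
Qed.

Lemma ord_toN s j k : ord_to (~~ s) j k = ord_to s k j.
Proof. by case: s. Qed.

Lemma ord_to_shift s (i j k : int) : ord_to s (i + k) (j + k) = ord_to s i j.
Proof. by rewrite /ord_to !lerD2r. Qed.

End one_sided.

(** * Cumulative weights and the two estimates for the R- and L-spaces *)

Section cumulative_weight.
Context (R : realType).
Variables (s : bool) (r : \bar R) (a b : R -> R).
Hypotheses (r0 : 0 < r) (sva : slowly_varying a) (svb : slowly_varying b).

Let a0 t : (0 < t)%R -> (0 < a t)%R. Proof. by case: sva => h _ _; exact: h. Qed.
Let b0 t : (0 < t)%R -> (0 < b t)%R. Proof. by case: svb => h _ _; exact: h. Qed.

Definition log_ratio (x : R) : R := (lg b x - lg a x)%R.

Lemma sv_log_ratio : sv log_ratio.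
Proof.
rewrite /log_ratio; apply: svD; first exact: sv_lg.
have := svZ (-1) (sv_lg sva); congr sv; apply/funext => x; ring.
Qed.

Lemma ratioE (t : R) (X : \bar R) : (0 < t)%R ->
  (t `^ (- invq r) * (b t / a t))%R%:E * X =
  eE (- invq r * ln t) * (eE (log_ratio (ln t)) * X).
Proof.
move=> t0; rewrite eE_mul /powR gt_eqF// (lgE t0 (b0 t0)) (lgE t0 (a0 t0)).
by rewrite -expRN -!expRD /lg.
Qed.

Lemma log_ratio_step : exists c : R, forall x y : R, (`|x - y| <= 1)%R ->
  (log_ratio x <= c + log_ratio y)%R.
Proof.
have [c hc] := sv_log_ratio ltr01; exists (c + 1)%R => x y xy.
have := hc x y; have := ler_norm (log_ratio x - log_ratio y); lra.
Qed.

(** Discrete form of the cumulative norm of b/a up to block [n]. The strict variant below omits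
    block [n] itself, which is only partly covered by a ray. *)
Definition block_weight (n : int) : \bar R :=
  lq r (fun j => if ord_to s j n then eE (log_ratio j%:~R) else 0).

Definition strict_block_weight (n : int) : \bar R :=
  lq r (fun j => if ord_to s j n && (j != n) then eE (log_ratio j%:~R) else 0).

(** The weight lives on the ray opposite to that of the inner norm: (0, t) for the R-space, (t, oo)
    for the L-space. *)
Definition ray_weight (t : R) := weight_norm r b a (ray (~~ s) t).

Lemma if_ge0 (B : bool) (x : R) : 0 <= (if B then eE x else 0).
Proof. by case: B; rewrite ?eE_ge0. Qed.

Lemma ray_weight_le : exists c : R, forall t, (0 < t)%R ->
  ray_weight t <= eE c * block_weight (Num.floor (ln t)).
Proof.
have [c hc] := log_ratio_step; exists (c + `|invq r|)%R => t t0.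
apply: LqOn_le_lq => // [k|u|u|u]; first exact: if_ge0.
- exact: ray_gt0.
- move=> /(ray_gt0 t0) u0; rewrite lee_fin mulr_ge0 ?powR_ge0//.
  by rewrite divr_ge0// ltW// ?a0 ?b0.
- move=> h; have u0 := ray_gt0 t0 h; rewrite -[leLHS]mule1 ratioE// mule1.
  rewrite -ord_toN (ray_ord t0 h); apply: eE_le.
  by rewrite -EFinM -expRD lee_fin ler_expR hc// floor_dist.
Qed.

Lemma strict_block_weight_le : exists c : R, forall t, (0 < t)%R ->
  strict_block_weight (Num.floor (ln t)) <= eE c * ray_weight t.
Proof.
have [c hc] := log_ratio_step; exists (c + `|invq r|)%R => t t0.
apply: lq_le_LqOn => // [k|u|u|u]; first exact: if_ge0.
- move=> /(ray_gt0 t0) u0; rewrite lee_fin mulr_ge0 ?powR_ge0//.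
  by rewrite divr_ge0// ltW// ?a0 ?b0.
- move=> u0 nray; case: ifPn => // /andP[h1 h2]; exfalso; apply: nray.
  by apply: ord_ray; rewrite // ?ord_toN// eq_sym.
- move=> u0 h; rewrite -[leRHS]mule1 ratioE// mule1; apply: eE_le.
  case: ifPn => _; last by rewrite mule0 eE_ge0.
  rewrite -EFinM -expRD lee_fin ler_expR.
  by have := hc (Num.floor (ln u))%:~R (ln u);
  rewrite distrC floor_dist => /(_ isT); lra.
Qed.

(** Translating the summation index by [n - m] matches the two index sets and changes [log_ratio] by
    at most c + e |n - m|. This makes cumulative weights slowly varying. *)
Lemma block_weight_shift (e : R) : (0 < e)%R -> exists c : R, forall m n : int,
  block_weight n <= eE (c + e * `|(n - m)%:~R|) * block_weight m.
Proof.
move=> e0; have [c hc] := sv_log_ratio e0; exists c => m n.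
rewrite /block_weight -[leLHS](lq_shift _ _ (n - m)); apply: le_lq => // k.
- exact: if_ge0.
- exact: if_ge0.
- have -> : ord_to s (k + (n - m)) n = ord_to s k m.
    by rewrite -[RHS](ord_to_shift _ _ _ (n - m)) [(m + _)%R]addrC subrK.
  case: (ord_to s k m); last exact: eE_mul_ge0.
  rewrite -EFinM -expRD lee_fin ler_expR.
  have := hc (k + (n - m))%:~R k%:~R.
  have -> : ((k + (n - m))%:~R - k%:~R = (n - m)%:~R :> R)%R by rewrite intrD; ring.
  by have := ler_norm (log_ratio (k + (n - m))%:~R - log_ratio k%:~R); lra.
Qed.

(** A shift by one index moves the boundary block strictly inside, while [log_ratio] changes by a
    bounded amount. *)
Lemma block_weight_le_strict : exists c : R, forall n,
  block_weight n <= eE c * strict_block_weight n.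
Proof.
have [c hc] := log_ratio_step; exists c => n.
pose d : int := if s then (-1)%R else 1%R.
rewrite /strict_block_weight -[X in _ <= _ * X](lq_shift _ _ d); apply: le_lq => // k.
- exact: if_ge0.
- exact: if_ge0.
- case: ifPn => h; last by rewrite eE_mul_ge0// if_ge0.
  have -> : ord_to s (k + d) n && ((k + d)%R != n).
    by move: h; rewrite /ord_to /d; case: (s) => h; apply/andP; split; lia.
  rewrite -EFinM -expRD lee_fin ler_expR hc//.
  rewrite -intrB opprD addrA subrr add0r rmorphN normrN.
  by rewrite /d; case: (s); rewrite ?rmorphN ?normrN normr1.
Qed.

Lemma ratio_le_block_weight n : eE (log_ratio n%:~R) <= block_weight n.
Proof.
have := lq_ub n r0 (fun k => if_ge0 (ord_to s k n) (log_ratio k%:~R)).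
by rewrite /block_weight /ord_to; case: (s); rewrite lexx.
Qed.

Hypothesis W1 : ray_weight 1 < +oo.

(** The hypothesis on the ray at 1 bounds the strict weight of block 0, hence its full weight;
    shifting reaches every other block. *)
Lemma block_weight_fin n : block_weight n \is a fin_num.
Proof.
have [c hc] := block_weight_shift ltr01.
have [c' hc'] := block_weight_le_strict.
have [c'' hc''] := strict_block_weight_le.
rewrite ge0_fin_numE; last by apply: le_trans (ratio_le_block_weight n); exact: eE_ge0.
have := hc'' 1%R ltr01; rewrite ln1 floor0 => h.
have h2 := le_trans (hc' 0%R) (eE_le c' h).
apply: (le_lt_trans (le_trans (hc 0%R n) (eE_le _ h2))).
by rewrite !lte_mul_pinfty ?eE_ge0.
Qed.

Definition log_block_weight n := ln (fine (block_weight n)).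

Lemma block_weightE n : block_weight n = eE (log_block_weight n).
Proof.
rewrite /log_block_weight lnK ?fineK ?block_weight_fin// posrE fine_gt0//.
rewrite -ge0_fin_numE ?block_weight_fin ?andbT; last first.
  by apply: le_trans (ratio_le_block_weight n); exact: eE_ge0.
by apply: lt_le_trans (ratio_le_block_weight n); rewrite lte_fin expR_gt0.
Qed.

Lemma ray_weight_bounds : exists c : R, forall t, (0 < t)%R ->
  ray_weight t <= eE (c + log_block_weight (Num.floor (ln t))) /\
  eE (- c + log_block_weight (Num.floor (ln t))) <= ray_weight t.
Proof.
have [c hc] := ray_weight_le.
have [c' hc'] := block_weight_le_strict.
have [c'' hc''] := strict_block_weight_le.
exists (`|c| + `|c'| + `|c''|)%R => t t0; split.
  apply: (le_trans (hc t t0)); rewrite block_weightE -EFinM -expRD lee_fin ler_expR.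
  by have := ler_norm c; have := normr_ge0 c'; have := normr_ge0 c''; lra.
have := le_trans (hc' _) (eE_le c' (hc'' t t0)).
rewrite eE_mul => /eE_moveL; apply: le_trans.
rewrite block_weightE -EFinM -expRD lee_fin ler_expR.
by have := ler_norm c'; have := normr_ge0 c; have := ler_norm c''; lra.
Qed.

Lemma ray_weight_fin t : (0 < t)%R ->
  ray_weight t \is a fin_num /\ (0 < fine (ray_weight t))%R.
Proof.
move=> t0; have [c /(_ t t0)[h1 h2]] := ray_weight_bounds.
have h3 : 0 < ray_weight t by apply: lt_le_trans h2; rewrite lte_fin expR_gt0.
have h4 : ray_weight t < +oo by apply: (le_lt_trans h1); rewrite ltry.
by rewrite ge0_fin_numE ?ltW// fine_gt0// h3.
Qed.

Definition log_ray_weight (x : R) : R := ln (fine (ray_weight (expR x))).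

Lemma log_ray_weight_block : exists c : R, forall x,
  (`|log_ray_weight x - log_block_weight (Num.floor x)| <= c)%R.
Proof.
have [c hc] := ray_weight_bounds; exists c => x.
have [h1 h2] := hc _ (expR_gt0 x); have [f1 f2] := ray_weight_fin (expR_gt0 x).
have E : ray_weight (expR x) = eE (log_ray_weight x).
  by rewrite /log_ray_weight lnK ?posrE// fineK.
move: h1 h2; rewrite E expRK !lee_fin !ler_expR => h1 h2.
by rewrite ler_norml; apply/andP; split; lra.
Qed.

Lemma sv_log_ray_weight : sv log_ray_weight.
Proof.
move=> e e0; have [c hc] := block_weight_shift e0.
have [c' hc'] := log_ray_weight_block.
(* 2 c' replaces both arguments by their floors, and 2 e pays for the floors being up to 2 further
   apart than x and y. *)
exists (2 * c' + c + 2 * e)%R => x y.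
have H (m n : int) :
    (`|log_block_weight n - log_block_weight m| <= c + e * `|(n - m)%:~R|)%R.
  have := hc m n; rewrite !block_weightE -EFinM -expRD lee_fin ler_expR => h1.
  have := hc n m; rewrite !block_weightE -EFinM -expRD lee_fin ler_expR => h2.
  have h3 : (`|(m - n)%:~R| = `|(n - m)%:~R| :> R)%R by rewrite !intrB distrC.
  by rewrite h3 in h2; rewrite ler_norml; apply/andP; split; lra.
have h1 := hc' x; have h2 := hc' y; have h3 := H (Num.floor y) (Num.floor x).
have h4 : (`|(Num.floor x - Num.floor y)%:~R| <= `|x - y| + 2 :> R)%R.
  have k1 := floor_dist x; have k2 := floor_dist y.
  have -> : ((Num.floor x - Num.floor y)%:~R =
    (x - y) - (x - (Num.floor x)%:~R) + (y - (Num.floor y)%:~R) :> R)%R.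
    by rewrite intrB; ring.
  apply: (le_trans (ler_normD _ _)); apply: (le_trans (lerD (ler_normB _ _) (lexx _))).
  lra.
have h5 := ler_wpM2l (ltW e0) h4.
have -> : (log_ray_weight x - log_ray_weight y =
   (log_ray_weight x - log_block_weight (Num.floor x)) -
   (log_ray_weight y - log_block_weight (Num.floor y)) +
   (log_block_weight (Num.floor x) - log_block_weight (Num.floor y)))%R by ring.
apply: (le_trans (ler_normD _ _)); apply: (le_trans (lerD (ler_normB _ _) (lexx _))).
lra.
Qed.

Variables (q : \bar R) (sigma : R).
Hypothesis q0 : 0 < q.

(** The logarithm of c_0 ([s = true]) or c_1 ([s = false]) at e^x. *)
Let C (x : R) : R := (lg a x + log_ray_weight x)%R.

Lemma sv_cumulative : sv C.
Proof. by apply: svD; [exact: sv_lg|exact: sv_log_ray_weight]. Qed.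

Lemma inner_ge0 (V : zmodType) (N0 N1 : V -> \bar R) f u :
  (forall f, 0 <= N0 f) -> (forall f, 0 <= N1 f) -> (0 < u)%R ->
  0 <= (u `^ (- sigma - invq q) * a u)%R%:E * Kfun N0 N1 u f.
Proof.
move=> h0 h1 u0; rewrite mule_ge0 ?lee_fin ?mulr_ge0 ?powR_ge0//.
  exact/ltW/a0.
exact: Kfun_ge0 (ltW u0).
Qed.

Lemma outer_ge0 t (X : \bar R) : (0 < t)%R -> 0 <= X ->
  0 <= (t `^ (- invq r) * (b t / a t))%R%:E * X.
Proof.
move=> t0 X0; rewrite mule_ge0// lee_fin mulr_ge0 ?powR_ge0//.
by rewrite divr_ge0// ltW// ?a0 ?b0.
Qed.

(** Only block [n] is kept in the inner norm. The outer norm then still collects all blocks strictly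
    behind [n], and their weight is comparable to the cumulative weight at e^n. *)
Lemma interpRay_lower : exists c : R, forall (V : zmodType) (N0 N1 : V -> \bar R),
    (forall f, 0 <= N0 f) -> (forall f, 0 <= N1 f) -> forall f (n : int),
  eE (- sigma * n%:~R + C n%:~R) * Kfun N0 N1 (expR n%:~R) f <=
  eE c * interpRay s sigma r b q a N0 N1 f.
Proof.
have [c1 hc1] := weightedK_lip 1 sigma (sv_lg sva ltr01).
have [c2 hc2] := log_ratio_step.
have [c3 hc3] := block_weight_le_strict.
have [c4 hc4] := log_ray_weight_block.
pose c5 := (c1 + `|invq q| + c2 + `|invq r|)%R.
exists (c4 + c3 + c5)%R => V N0 N1 h0 h1 f n.
set Y := interpRay _ _ _ _ _ _ _ _ _.
have Y0 : 0 <= Y by exact: LqOn_ge0.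
suff H : weightedK sigma (lg a) N0 N1 f n%:~R <=
    eE (c4 + c3 + c5 - log_ray_weight n%:~R) * Y.
  have := eE_le (log_ray_weight n%:~R) H; rewrite /weightedK !eE_mul /C.
  have -> : (log_ray_weight n%:~R + (c4 + c3 + c5 - log_ray_weight n%:~R) =
    c4 + c3 + c5)%R by ring.
  apply: le_trans; rewrite le_eqVlt; apply/orP; left; apply/eqP.
  by congr (eE _ * _); ring.
apply: le_exp_below => [|u hu]; first exact: eE_mul_ge0.
(* The condition [j != n] guarantees that a ray starting in block [j] contains block [n]
   entirely. *)
suff H : lq r (fun j =>
      if ord_to s j n && (j != n) then eE (log_ratio j%:~R + u) else 0)
    <= eE c5 * Y.
  have h : strict_block_weight n <= eE (- u) * lq r (fun j =>
      if ord_to s j n && (j != n) then eE (log_ratio j%:~R + u) else 0).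
    apply: le_lq => // k; [exact: if_ge0|exact: if_ge0|].
    case: ifPn => _; last by rewrite mule0.
    by rewrite -EFinM -expRD lee_fin ler_expR; lra.
  have := le_trans (hc3 n) (eE_le c3 (le_trans h (eE_le (- u) H))).
  rewrite !eE_mul block_weightE => h2.
  have := eE_le (u - log_block_weight n) h2; rewrite eE_mul -EFinM -expRD subrK => h3.
  apply: (le_trans h3); apply: eE_homo => //.
  have := hc4 n%:~R; rewrite intrKfloor => h4.
  by have := ler_norm (log_ray_weight n%:~R - log_block_weight n); lra.
apply: lq_le_LqOn => // [k|t|t t0|t t0 _].
- exact: if_ge0.
- by rewrite /= in_itv/= andbT => t0; apply: outer_ge0 => //; exact: LqOn_ge0.
- by rewrite /= in_itv/= andbT t0.
rewrite ratioE//; apply: eE_le.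
case: ifPn => [/andP[h2 h3]|_]; last by rewrite mule0 eE_mul_ge0// LqOn_ge0.
have K : lq q (fun k => if k == n then eE u else 0) <=
    eE (c1 + `|invq q|) * LqOn q (ray s t)
      (fun v => (v `^ (- sigma - invq q) * a v)%R%:E * Kfun N0 N1 v f).
  apply: lq_le_LqOn => // [k|v|v v0 nray|v v0 hv]; first exact: if_ge0.
  - by move=> /(ray_gt0 t0); exact: inner_ge0.
  - case: eqP => // E; exfalso; apply: nray; apply: ord_ray => //; by rewrite E.
  - rewrite weightE ?a0//; apply: eE_le; case: eqP => E; last first.
      by rewrite mule0 eE_mul_ge0// Kfun_ge0// ltW.
    apply: eE_moveL; apply: (le_trans hu); rewrite -E.
    have := floor_dist (ln v); rewrite distrC => /(hc1 _ _ _ h0 h1 f).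
    by rewrite {2}/weightedK lnK.
have K2 : eE u <= lq q (fun k => if k == n then eE u else 0).
  have := lq_ub n q0 (fun k => if_ge0 (k == n) u); by rewrite eqxx.
have K3 := eE_moveL (le_trans K2 K).
apply: le_trans (eE_le _ K3); rewrite -!EFinM -!expRD lee_fin ler_expR.
have := hc2 (Num.floor (ln t))%:~R (ln t); rewrite distrC floor_dist => /(_ isT).
lra.
Qed.

(** Trades a bound that may be 0 or [+oo] for real exponentials above it, so that estimates become
    linear in the exponents. *)
Lemma le_exp_above (x B : \bar R) : 0 <= B ->
  (forall u : R, B <= eE u -> x <= eE u) -> x <= B.
Proof.
case: B => [B||]// B0 h; last by rewrite leey.
apply/lee_addgt0Pr => d d0; have p : (0 < B + d)%R.
  by move: B0; rewrite lee_fin => B0; rewrite ltr_wpDl.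
have := h (ln (B + d)); rewrite lnK ?posrE// -EFinD; apply.
by rewrite lee_fin lerDl ltW.
Qed.

(** The decay rate e is spent in quarters: on the variation of a, on summing the inner norm, on the
    variation of b/a, and on summing the outer norm. *)
Lemma interpRay_upper (e : R) : (0 < e)%R ->
  exists c : R, forall (V : zmodType) (N0 N1 : V -> \bar R),
    (forall f, 0 <= N0 f) -> (forall f, 0 <= N1 f) -> forall f (n : int) (B : \bar R),
    0 <= B ->
    (forall k : int, Kfun N0 N1 (expR k%:~R) f <=
       eE (sigma * k%:~R - C n%:~R - e * `|(k - n)%:~R|) * B) ->
  interpRay s sigma r b q a N0 N1 f <= eE c * B.
Proof.
move=> e0; have e40 : (0 < e / 4)%R by rewrite divr_gt0.
have [c1 hc1] := weightedK_lip 1 sigma (sv_lg sva ltr01).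
have [c2 hc2] := log_ratio_step.
have [ca hca] := sv_lg sva e40.
have [cb hcb] := sv_log_ratio e40.
have [cg hcg] := lq_geom q0 e40.
have [ch hch] := lq_geom r0 e40.
have [c4 hc4] := log_ray_weight_block.
exists (c2 + `|invq r| + invq r + (`|cb| + `|ch|) + c1 + `|invq q| + ca + cg + c4)%R.
move=> V N0 N1 h0 h1 f n B B0 hB.
apply: eE_moveR; apply: le_exp_above => // u hu.
apply: eE_moveL; rewrite -EFinM -expRD.
(* Decay of the inner norm over a ray from block [j]: none while block [n] can still meet the ray,
   half the rate beyond. *)
pose E (j : int) : R := if ord_to s j n then 0%R else (e / 2 * `|(j - n)%:~R|)%R.
pose A := (ca - log_ray_weight n%:~R + u)%R.
have hz (k : int) : weightedK sigma (lg a) N0 N1 f k%:~R <=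
    eE (A - 3 * (e / 4) * `|(k - n)%:~R|).
  rewrite /weightedK; apply: (le_trans (eE_le _ (le_trans (hB k) (eE_le _ hu)))).
  rewrite -!EFinM -!expRD lee_fin ler_expR /C /A.
  have := hca k%:~R n%:~R; rewrite -intrB.
  have := ler_norm (lg a k%:~R - lg a n%:~R); lra.
pose A' := (c1 + `|invq q| + A + cg)%R.
have hin t : (0 < t)%R -> LqOn q (ray s t)
      (fun v => (v `^ (- sigma - invq q) * a v)%R%:E * Kfun N0 N1 v f) <=
    eE (A' - E (Num.floor (ln t))).
  move=> t0; set j := Num.floor (ln t).
  have z0 k : 0 <= (if ord_to s j k then weightedK sigma (lg a) N0 N1 f k%:~R else 0).
    by case: ifP => // _; rewrite eE_mul_ge0// Kfun_ge0// expR_ge0.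
  apply: (@le_trans _ _ (eE (c1 + `|invq q|) * lq q
    (fun k => if ord_to s j k then weightedK sigma (lg a) N0 N1 f k%:~R else 0))).
    apply: LqOn_le_lq => // [v|v|v hv]; first exact: ray_gt0.
      by move=> /(ray_gt0 t0); exact: inner_ge0.
    have v0 := ray_gt0 t0 hv.
    rewrite weightE ?a0//; apply: eE_le; rewrite (ray_ord t0 hv).
    by have := hc1 _ _ _ h0 h1 f _ _ (floor_dist (ln v)); rewrite {1}/weightedK lnK.
  have -> : eE (A' - E j) = eE (c1 + `|invq q|) * (eE (A - E j) * eE cg).
    by rewrite -!EFinM -!expRD; congr (_%:E); congr expR; rewrite /A'; ring.
  apply: eE_le; apply: (le_trans _ (eE_le _ (hcg n))).
  apply: le_lq => // k; case: ifPn => hjk; last by rewrite eE_mul_ge0// eE_ge0.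
  apply: (le_trans (hz k)); rewrite -EFinM -expRD lee_fin ler_expR.
  (* Of the available rate 3e/4, e/4 sums over [k]. When [n] is behind [j], every [k] on the ray is
     at least as far from [n] as [j] is, and the other e/2 gives [E j]. *)
  have -> : (`|(n - k)%:~R| = `|(k - n)%:~R| :> R)%R by rewrite !intrB distrC.
  rewrite /E; case: ifPn => hjn; first by have := normr_ge0 ((k - n)%:~R : R); nra.
  suff : (`|(j - n)%:~R| <= `|(k - n)%:~R| :> R)%R by nra.
  rewrite -!intr_norm ler_int; move: hjk hjn.
  by rewrite /ord_to; case: (s); lia.
pose y (j : int) : \bar R := eE (log_ratio j%:~R + A' - E j).
apply: (@le_trans _ _ (eE (c2 + `|invq r|) * lq r y)).
  apply: LqOn_le_lq => // [k|t|t|t]; first exact: eE_ge0.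
  - by rewrite /= in_itv/= andbT.
  - by rewrite /= in_itv/= andbT => t0; apply: outer_ge0 => //; exact: LqOn_ge0.
  - rewrite /= in_itv/= andbT => t0; rewrite ratioE//; apply: eE_le.
    apply: (le_trans (eE_le _ (hin t t0))); rewrite -!EFinM -!expRD lee_fin ler_expR.
    have := hc2 _ _ (floor_dist (ln t)); lra.
apply: (@le_trans _ _ (eE (c2 + `|invq r|) *
   (eE (invq r) * eE (A' + log_block_weight n + (`|cb| + `|ch|))))); last first.
  rewrite -!EFinM -!expRD lee_fin ler_expR /A' /A.
  have := hc4 n%:~R; rewrite intrKfloor => h4.
  by have := ler_norm (log_block_weight n - log_ray_weight n%:~R); rewrite distrC; lra.
apply: eE_le.
(* Up to [n] the sum is the block weight. Beyond [n], [log_ratio] uses e/4 of the decay, and a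
   geometric series times the ratio at [n], itself below the block weight, remains. *)
pose u1 (j : int) := if ord_to s j n then eE (log_ratio j%:~R + A') else 0.
pose v1 (j : int) := eE (log_ratio n%:~R + cb + A') * eE (- (e / 4) * `|(n - j)%:~R|).
apply: (@lq_split _ _ _ u1 v1) => // [k|k|k|k||].
- exact: eE_ge0.
- exact: if_ge0.
- by rewrite eE_mul_ge0// eE_ge0.
- rewrite /y /u1 /E; case: ifPn => _; first by left; rewrite subr0.
  right; rewrite /v1 -EFinM -expRD lee_fin ler_expR.
  have := hcb k%:~R n%:~R; rewrite -intrB.
  have -> : (`|(n - k)%:~R| = `|(k - n)%:~R| :> R)%R by rewrite !intrB distrC.
  have := ler_norm (log_ratio k%:~R - log_ratio n%:~R); lra.
- apply: (@le_trans _ _ (eE A' * block_weight n)).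
    apply: le_lq => // k; [exact: if_ge0|exact: if_ge0|].
    rewrite /u1; case: ifPn => _; last by rewrite mule0.
    by rewrite -EFinM -expRD addrC.
  rewrite block_weightE -EFinM -expRD lee_fin ler_expR lerDl addr_ge0//.
- apply: (@le_trans _ _ (eE (log_ratio n%:~R + cb + A') * eE ch)).
    apply: le_trans (eE_le _ (hch n)); apply: le_lq => // k.
    by rewrite eE_mul_ge0// eE_ge0.
  rewrite -EFinM -expRD lee_fin ler_expR.
  have := ratio_le_block_weight n; rewrite block_weightE lee_fin ler_expR.
  by have := ler_norm cb; have := ler_norm ch; lra.
Qed.

End cumulative_weight.

(** * Almost optimal decompositions *)

Section decomposition.
Context (R : realType).

Lemma quasinorm_eE (K : numFieldType) (m : K -> R) (V : lmodType K) (N : V -> \bar R) :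
  quasinorm m N ->
  exists c : R, forall d, (c <= d)%R -> forall f g, N (f + g)%R <= eE d * (N f + N g).
Proof.
move=> [N0 _ _ [C C1 hC]]; have C0 : (0 < C)%R by lra.
exists (ln C) => d cd f g; apply: (le_trans (hC f g)); rewrite lee_wpmul2r ?adde_ge0//.
by rewrite lee_fin -[leLHS]lnK ?posrE// ler_expR.
Qed.

Lemma quasinormN (K : numFieldType) (m : K -> R) (V : lmodType K) (N : V -> \bar R) :
  modulus m -> quasinorm m N -> forall f, N (- f)%R = N f.
Proof.
move=> [iota [iota_le iotaE]] [_ _ NZ _] f.
have m1 : m (-1)%R = 1%R.
  apply: (fmorph_inj iota); rewrite -iotaE normrN normr1 rmorph1//.
by rewrite -scaleN1r NZ m1 mul1e.
Qed.

Lemma Kfun_add (V : zmodType) (N0 N1 : V -> \bar R) (c t : R) :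
    (forall f, 0 <= N0 f) -> (forall f, 0 <= N1 f) ->
    (forall f g, N0 (f + g)%R <= eE c * (N0 f + N0 g)) ->
    (forall f g, N1 (f + g)%R <= eE c * (N1 f + N1 g)) ->
    (0 < t)%R -> forall f g,
  Kfun N0 N1 t (f + g)%R <= eE c * (Kfun N0 N1 t f + Kfun N0 N1 t g).
Proof.
move=> h0 h1 q0 q1 t0 f g.
have Kf := Kfun_ge0 h0 h1 f (ltW t0); have Kg := Kfun_ge0 h0 h1 g (ltW t0).
have e0 : 0 < eE c by rewrite lte_fin expR_gt0.
have [fy|fy] := eqVneq (Kfun N0 N1 t f) +oo.
  by rewrite fy addye ?gt0_muley ?leey// gt_eqF// (lt_le_trans _ Kg).
have [gy|gy] := eqVneq (Kfun N0 N1 t g) +oo.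
  by rewrite gy addey ?gt0_muley ?leey// gt_eqF// (lt_le_trans _ Kf).
have ff : Kfun N0 N1 t f \is a fin_num by rewrite ge0_fin_numE// ltey.
have gf : Kfun N0 N1 t g \is a fin_num by rewrite ge0_fin_numE// ltey.
apply: eE_moveR; apply/lee_addgt0Pr => d d0.
have d20 : (0 < d / 2)%R by rewrite divr_gt0.
have [_ [[f0 f1] [/= cf0 cf1 ->] <-] hf] := lb_ereal_inf_adherent d20 ff.
have [_ [[g0 g1] [/= cg0 cg1 ->] <-] hg] := lb_ereal_inf_adherent d20 gf.
rewrite -/(Kfun N0 N1 t f) in hf; rewrite -/(Kfun N0 N1 t g) in hg.
have c0 : carrier N0 (f0 + g0)%R.
  apply: (le_lt_trans (q0 _ _)).
  by rewrite lte_mul_pinfty ?eE_ge0// lte_add_pinfty.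
have c1 : carrier N1 (f1 + g1)%R.
  apply: (le_lt_trans (q1 _ _)).
  by rewrite lte_mul_pinfty ?eE_ge0// lte_add_pinfty.
rewrite [X in Kfun N0 N1 t X](_ : _ = (f0 + g0) + (f1 + g1))%R; last by rewrite addrACA.
apply: (@le_trans _ _ ((N0 f0 + t%:E * N1 f1) + (N0 g0 + t%:E * N1 g1))); last first.
  apply: (le_trans (leeD (ltW hf) (ltW hg))).
  by rewrite addeACA -EFinD -splitr.
apply: eE_moveL; apply: (le_trans (Kfun_le t c0 c1)).
rewrite addeACA -[X in eE c * (_ + X)]ge0_muleDr//.
rewrite [leRHS]ge0_muleDr ?adde_ge0 ?mule_ge0 ?adde_ge0 ?lee_fin ?(ltW t0)//.
by apply: leeD; [exact: q0|rewrite muleCA lee_wpmul2l ?lee_fin ?(ltW t0)].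
Qed.

Lemma adde_le_expR2 (a b : \bar R) : 0 <= a -> b <= eE 1 * a -> a + b <= eE 2 * a.
Proof.
move=> a0 ba; apply: (le_trans (leeD (lexx a) ba)).
rewrite -[X in X + _]mul1e -ge0_muleDl ?eE_ge0// lee_wpmul2r//.
rewrite -EFinD lee_fin (_ : 2 = 1 + 1)%R// expRD.
by have := expR_ge1Dx (1 : R); nra.
Qed.

Lemma adde_self_le (a : \bar R) : 0 <= a -> a + a <= eE 1 * a.
Proof.
move=> a0; rewrite -[X in X + _ <= _]mul1e -[X in _ + X <= _]mul1e.
rewrite -ge0_muleDl// lee_wpmul2r// -EFinD lee_fin.
exact: expR_ge1Dx.
Qed.

(** If K vanishes, f splits into pieces arbitrarily small in both quasi-norms; by continuity of the
    embeddings and of addition f lies in every neighbourhood of 0, so f = 0 by separation. *)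
Lemma Kfun_eq0 (K : numFieldType) (m : K -> R) (V : topologicalLmodType K)
    (N0 N1 : V -> \bar R) (t : R) (f : V) :
  compatible_couple m N0 N1 -> (0 < t)%R -> Kfun N0 N1 t f = 0 -> f = 0%R.
Proof.
move=> [hV [[n0 _ _ _] _ c0] [[n1 _ _ _] _ c1]] t0 K0; apply: contrapT => /eqP f0.
move: hV; rewrite open_hausdorff => /(_ _ _ f0)[[A B] [/= fA zB] [oA oB AB]].
have : nbhs (0%R : V) B by apply: open_nbhs_nbhs; split=> //; rewrite inE in zB.
move=> nB; have := @add_continuous V (0%R, 0%R) B; rewrite /= addr0 => /(_ nB).
move=> [[U1 U2] [/= nU1 nU2] hU].
have [e1 e10 he1] := c0 _ nU1; have [e2 e20 he2] := c1 _ nU2.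
(* A total cost below this minimum forces the first piece under [e1] and the second under [e2]. *)
have m0 : 0 < (Num.min e1 (t * e2))%:E by rewrite lte_fin lt_min e10 mulr_gt0.
have [_ [[f0' f1'] [/= _ _ fE] <-]] : exists2 y, [set N0 g.1 + t%:E * N1 g.2 | g in
    [set g : V * V | [/\ carrier N0 g.1, carrier N1 g.2 & f = (g.1 + g.2)%R]]] y &
    y < (Num.min e1 (t * e2))%:E.
  by apply: ereal_inf_lt; rewrite -/(Kfun N0 N1 t f) K0.
move=> h; have k0 : N0 f0' < e1%:E.
  apply: (@le_lt_trans _ _ (N0 f0' + t%:E * N1 f1')).
    by rewrite leeDl// mule_ge0// lee_fin ltW.
  by apply: (lt_le_trans h); rewrite lee_fin ge_min lexx.
have k1 : N1 f1' < e2%:E.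
  rewrite -(@lte_pmul2l _ t%:E)//.
  apply: (@le_lt_trans _ _ (N0 f0' + t%:E * N1 f1')); first by rewrite leeDr.
  by apply: (lt_le_trans h); rewrite -EFinM lee_fin ge_min lexx orbT.
have Bf : B f by rewrite fE; apply: (hU (f0', f1')); split; [exact: he1|exact: he2].
by move: AB => /eqP/seteqP[/(_ f) + _]; apply; split=> //; rewrite inE in fA.
Qed.

(** At e^n take a decomposition optimal up to the factor e. Two of the bounds come from K(t, f0) <=
    N0 f0 and K(t, f1) <= t N1 f1, the other two from f0 = f - f1 and f1 = f - f0. *)
Lemma Kfun_decomposition (K : numFieldType) (m : K -> R) (V : topologicalLmodType K)
    (N0 N1 : V -> \bar R) : modulus m -> compatible_couple m N0 N1 ->
  exists c : R, forall (n : int) (f : V), Kfun N0 N1 (expR n%:~R) f < +oo ->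
    exists f0 f1 : V, f = (f0 + f1)%R /\ forall k : int,
     let kap (j : int) g := Kfun N0 N1 (expR j%:~R) g in
     ((k <= n)%R -> kap k f0 <= eE c * kap k f /\
                    kap k f1 <= eE (c + (k%:~R - n%:~R)) * kap n f) /\
     ((n <= k)%R -> kap k f0 <= eE c * kap n f /\ kap k f1 <= eE c * kap k f).
Proof.
move=> hm hN; have [_ [Q0 _ _] [Q1 _ _]] := hN.
have n0 : forall f, 0 <= N0 f by case: Q0.
have n1 : forall f, 0 <= N1 f by case: Q1.
have z0 : N0 0%R = 0 by case: Q0 => _ /(_ 0%R)[_ ->].
have z1 : N1 0%R = 0 by case: Q1 => _ /(_ 0%R)[_ ->].
have [cq0 hq0] := quasinorm_eE Q0; have [cq1 hq1] := quasinorm_eE Q1.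
pose cq := Num.max 0%R (Num.max cq0 cq1).
have cqge0 : (0 <= cq)%R by rewrite le_max lexx.
have {}hq0 : forall f g, N0 (f + g)%R <= eE cq * (N0 f + N0 g).
  by apply: hq0; rewrite !le_max lexx orbT.
have {}hq1 : forall f g, N1 (f + g)%R <= eE cq * (N1 f + N1 g).
  by apply: hq1; rewrite !le_max lexx !orbT.
exists (cq + 2)%R => n f Kf.
have Kge0 (j : int) g : 0 <= Kfun N0 N1 (expR j%:~R) g by exact: Kfun_ge0 (expR_ge0 _).
have [f0 [f1 [fE c0 c1 hK]]] : exists f0 f1 : V, [/\ f = (f0 + f1)%R,
    carrier N0 f0, carrier N1 f1 &
    N0 f0 + eE n%:~R * N1 f1 <= eE 1 * Kfun N0 N1 (expR n%:~R) f].
  (* A multiplicative slack is void when K vanishes; in that case f = 0 and the zero decomposition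
     serves. *)
  have [K0|K0] := eqVneq (Kfun N0 N1 (expR n%:~R) f) 0.
    exists 0%R, 0%R; have -> := Kfun_eq0 hN (expR_gt0 _) K0.
    by split; rewrite ?addr0//= ?/carrier/= ?z0 ?z1 ?mule0 ?adde0 ?eE_mul_ge0.
  have h : Kfun N0 N1 (expR n%:~R) f < eE 1 * Kfun N0 N1 (expR n%:~R) f.
    have Kp : 0 < Kfun N0 N1 (expR n%:~R) f by rewrite lt0e K0 Kge0.
    rewrite -{1}[X in X < _]mul1e lte_pmul2r//; last by rewrite ge0_fin_numE.
    by rewrite lte_fin expR_gt1.
  have [_ [[g0 g1] [/= h1 h2 h3] <-] h4] := ereal_inf_lt h.
  by exists g0, g1; split=> //; exact: ltW.
have b0 : N0 f0 <= eE 1 * Kfun N0 N1 (expR n%:~R) f.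
  by apply: le_trans hK; rewrite leeDl// eE_mul_ge0.
have b1 : N1 f1 <= eE (1 - n%:~R) * Kfun N0 N1 (expR n%:~R) f.
  rewrite addrC -eE_mul; apply: eE_moveR; rewrite opprK.
  by apply: le_trans hK; rewrite leeDr.
have k0 (j : int) g : carrier N0 g -> Kfun N0 N1 (expR j%:~R) g <= N0 g.
  move=> cg; have := Kfun_le (expR j%:~R) cg (_ : carrier N1 0%R).
  by rewrite addr0 z1 mule0 adde0; apply; rewrite /carrier/= z1.
have k1 (j : int) g : carrier N1 g -> Kfun N0 N1 (expR j%:~R) g <= eE j%:~R * N1 g.
  move=> cg; have := Kfun_le (expR j%:~R) (_ : carrier N0 0%R) cg.
  by rewrite add0r z0 add0e; apply; rewrite /carrier/= z0.
have N0N := quasinormN hm Q0; have N1N := quasinormN hm Q1.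
exists f0, f1; split=> [|k]; first exact: fE.
set kap := fun (j : int) g => Kfun N0 N1 (expR j%:~R) g.
rewrite -!/(kap _ _).
have kap1 : kap k f1 <= eE (1 + (k%:~R - n%:~R)) * kap n f.
  apply: (le_trans (k1 k f1 c1)); apply: (le_trans (eE_le _ b1)).
  by rewrite eE_mul; apply: eE_homo; [exact: Kge0|lra].
have kap0 : kap k f0 <= eE 1 * kap n f by apply: (le_trans (k0 k f0 c0)).
split=> kn; split.
(* For k <= n, K(e^k, f1) <= e^(1+k-n) K(e^n, f) <= e K(e^k, f), since K(t)/t is nonincreasing; then
   1 + e <= e^2. *)
- have -> : f0 = (f + - f1)%R by rewrite fE addrK.
  apply: (le_trans (Kfun_add n0 n1 hq0 hq1 (expR_gt0 _) _ _)).
  rewrite -(eE_mul cq 2); apply: eE_le; apply: adde_le_expR2; first exact: Kge0.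
  have cn1 : carrier N1 (- f1)%R by rewrite /carrier/= N1N.
  apply: (le_trans (k1 k _ cn1)); rewrite N1N; apply: (le_trans (eE_le _ b1)).
  rewrite eE_mul; have := Kfun_quot n0 n1 f (_ : (k%:~R <= n%:~R :> R)%R).
  rewrite ler_int => /(_ kn) /(eE_le (k%:~R + (1 - n%:~R))) /le_trans; apply.
  by rewrite eE_mul; apply: eE_homo; [exact: Kge0|lra].
- by apply: (le_trans kap1); apply: eE_homo; [exact: Kge0|lra].
- by apply: (le_trans kap0); apply: eE_homo; [exact: Kge0|lra].
- have -> : f1 = (f + - f0)%R by rewrite fE addrC addKr.
  apply: (le_trans (Kfun_add n0 n1 hq0 hq1 (expR_gt0 _) _ _)).
  rewrite -(eE_mul cq 2); apply: eE_le; apply: adde_le_expR2; first exact: Kge0.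
  have cn0 : carrier N0 (- f0)%R by rewrite /carrier/= N0N.
  apply: (le_trans (k0 k _ cn0)); rewrite N0N; apply: (le_trans b0); apply: eE_le.
  by apply: Kfun_homo; rewrite ?expR_ge0// ler_expR ler_int.
Qed.

End decomposition.

(** * Growth of a linear function with a slowly varying perturbation *)

Section growth.
Context (R : realType).
Variables (d : R) (L : R -> R).
Hypotheses (d0 : (0 < d)%R) (svL : sv L).

Let P (x : R) : R := (d * x + L x)%R.

Lemma growth_lip : exists c : R, (0 <= c)%R /\
  forall x y, (`|P x - P y| <= c + (d + 1) * `|x - y|)%R.
Proof.
have [c hc] := svL ltr01; exists c; split; first exact: coarse_lip_ge0 hc.
move=> x y; have -> : (P x - P y = d * (x - y) + (L x - L y))%R by rewrite /P; ring.
apply: (le_trans (ler_normD _ _)); rewrite normrM (gtr0_norm d0).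
by have := hc x y; lra.
Qed.

(** Taking slow variation at rate d/2 leaves half of the slope d. *)
Lemma growth_sep : exists c : R, (0 <= c)%R /\
  (forall x y, x <= y -> d / 2 * (y - x) - c <= P y - P x)%R /\
  (forall m n : int, d / 2 * `|(m - n)%:~R| - c <= `|P m%:~R - P n%:~R|)%R.
Proof.
have d20 : (0 < d / 2)%R by rewrite divr_gt0.
have [c hc] := svL d20; exists c; have c0 := coarse_lip_ge0 hc; split=> //.
have H (x y : R) : (x <= y)%R -> (d / 2 * (y - x) - c <= P y - P x)%R.
  move=> xy; have := hc x y.
  have -> : (`|x - y| = y - x)%R by rewrite distrC ger0_norm ?subr_ge0.
  have := ler_norm (L x - L y); rewrite /P; lra.
split=> // m n; wlog mn : m n / (n <= m)%R.
  move=> h; case: (leP n m) => [|/ltW] mn; first exact: h.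
  by have := h n m mn; rewrite !intrB distrC [X in (_ <= X)%R]distrC.
have mnR : (n%:~R <= m%:~R :> R)%R by rewrite ler_int.
rewrite intrB ger0_norm ?subr_ge0//.
by apply: (le_trans (H _ _ mnR)); exact: ler_norm.
Qed.

(** A substitute for the intermediate value theorem, since [P] may be discontinuous: near the
    supremum of the points with P x <= t, [P] crosses [t] within a unit step, over which it varies
    by a bounded amount. Rounding to an integer doubles the constant. *)
Lemma growth_inverse : exists c : R, forall t : R, exists n : int,
  (`|P n%:~R - t| <= c)%R.
Proof.
have [c1 [c10 hc1]] := growth_lip; have [c2 [c20 [hc2 _]]] := growth_sep.
exists (2 * (c1 + (d + 1)))%R => t.
pose S := [set x : R | (P x <= t)%R].
have d20 : (0 < d / 2)%R by rewrite divr_gt0.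
(* Chosen so that P(-z) <= t and P x > t for every x > z. *)
pose z := ((`|P 0| + c2 + `|t|) / (d / 2))%R.
have z0 : (0 <= z)%R by rewrite divr_ge0 ?addr_ge0// ltW.
have zE : (d / 2 * z = `|P 0| + c2 + `|t|)%R by rewrite /z mulrC divfK// gt_eqF.
have n1 := ler_norm (P 0); have n2 := ler_norm t.
have n3 := ler_norm (- P 0)%R; have n4 := ler_norm (- t)%R.
rewrite !normrN in n3 n4.
have S0 : S (- z)%R.
  by rewrite /S/=; have := hc2 (- z)%R 0%R; rewrite oppr_le0 => /(_ z0); lra.
have supS : has_sup S.
  split; first by exists (- z)%R.
  exists z => x; rewrite /S/= => hx; rewrite leNgt; apply/negP => zx.
  have := hc2 0%R x (ltW (le_lt_trans z0 zx)).
  have := ltr_pM2l d20 z x; rewrite zx subr0; lra.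
have [x Sx hx] := sup_adherent ltr01 supS.
have tx : (t < P (x + 1))%R.
  rewrite ltNge; apply/negP => h.
  by have := sup_upper_bound supS h; lra.
have k1 := hc1 (x + 1)%R x; have k2 := hc1 x (Num.floor x)%:~R.
have k3 := ler_wpM2l (_ : 0 <= d + 1)%R (floor_dist x).
exists (Num.floor x).
rewrite (_ : x + 1 - x = 1)%R in k1; last by ring.
rewrite normr1 in k1.
have k4 := ler_norm (P (x + 1) - P x).
have k5 : (`|P x - t| <= c1 + (d + 1))%R.
  rewrite distrC ger0_norm ?subr_ge0//; lra.
have -> : (P (Num.floor x)%:~R - t = (P x - t) - (P x - P (Num.floor x)%:~R))%R by ring.
apply: (le_trans (ler_normB _ _)).
have d10 : (0 <= d + 1)%R by lra.
have := k3 d10; lra.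
Qed.

End growth.

(** * Reiteration from the two one-sided estimates *)

Section reiteration.
Context (R : realType) (K : numFieldType) (m : K -> R) (V : topologicalLmodType K).
Variables (N0 N1 : V -> \bar R).
Hypotheses (hm : modulus m) (hN : compatible_couple m N0 N1).
Variables (Y0 Y1 : V -> \bar R) (t0 t1 th : R) (C0 C1 A : R -> R).
Hypotheses (t0_gt0 : (0 < t0)%R) (t01 : (t0 < t1)%R) (t1_lt1 : (t1 < 1)%R)
  (th01 : (0 < th < 1)%R).
Hypotheses (Y0_ge0 : forall f, 0 <= Y0 f) (Y1_ge0 : forall f, 0 <= Y1 f).
Hypotheses (svC0 : sv C0) (svC1 : sv C1) (svA : sv A).

Let d := (t1 - t0)%R.
(** With [C0], [C1], [A] the logarithms of c_0, c_1, a at e^x, [P] is that of rho and [S] below that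
    of a#. *)
Let P (x : R) : R := (d * x + (C0 x - C1 x))%R.
Let eta := ((1 - th) * t0 + th * t1)%R.
Let S (x : R) : R := ((1 - th) * C0 x + th * C1 x + A (P x))%R.
Let kap (n : int) f := Kfun N0 N1 (expR n%:~R) f.

Let N0_ge0 f : 0 <= N0 f. Proof. by case: hN => _ [[h _ _ _] _ _] _; exact: h. Qed.
Let N1_ge0 f : 0 <= N1 f. Proof. by case: hN => _ _ [[h _ _ _] _ _]; exact: h. Qed.

Definition lower_bound (Y : V -> \bar R) (s : R) (C : R -> R) :=
  exists c : R, forall f (n : int),
    eE (- s * n%:~R + C n%:~R) * kap n f <= eE c * Y f.

Definition upper_bound (Y : V -> \bar R) (s : R) (C : R -> R) :=
  forall e : R, (0 < e)%R -> exists c : R, forall f (n : int) (B : \bar R), 0 <= B ->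
    (forall k : int, kap k f <= eE (s * k%:~R - C n%:~R - e * `|(k - n)%:~R|) * B) ->
  Y f <= eE c * B.

Hypotheses (low0 : lower_bound Y0 t0 C0) (low1 : lower_bound Y1 t1 C1).
Hypotheses (up0 : upper_bound Y0 t0 C0) (up1 : upper_bound Y1 t1 C1).

Let d_gt0 : (0 < d)%R. Proof. by rewrite subr_gt0. Qed.

Let svC01 : sv (fun x => C0 x - C1 x)%R.
Proof.
have := svD svC0 (svZ (-1) svC1); congr sv; apply/funext => x; ring.
Qed.

Lemma sv_S : sv S.
Proof.
apply: svD; first by apply: svD; exact: svZ.
have [c [_ hc]] := growth_lip d_gt0 svC01.
by apply: (@sv_comp _ (d + 1)) => //; exists c.
Qed.

(** The lower bounds are applied to both pieces of an arbitrary decomposition in (Y0, Y1); the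
    exponent for the second piece exceeds that for the first by exactly [P n]. *)
Lemma reiteration_lower : exists c : R, forall f (n : int),
  kap n f <= eE (c + t0 * n%:~R - C0 n%:~R) * Kfun Y0 Y1 (expR (P n%:~R)) f.
Proof.
have [c0 h0] := low0; have [c1 h1] := low1.
have [_ [Q0 _ _] [Q1 _ _]] := hN.
have [cq0 hq0] := quasinorm_eE Q0; have [cq1 hq1] := quasinorm_eE Q1.
pose cq := Num.max cq0 cq1.
have {}hq0 : forall f g, N0 (f + g)%R <= eE cq * (N0 f + N0 g).
  by apply: hq0; rewrite le_max lexx.
have {}hq1 : forall f g, N1 (f + g)%R <= eE cq * (N1 f + N1 g).
  by apply: hq1; rewrite le_max lexx orbT.
exists (cq + Num.max c0 c1)%R => f n.
apply: eE_moveR; apply: le_ereal_inf_tmp => _ [[g0 g1] [/= _ _ ->] <-].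
apply: eE_moveL.
apply: (le_trans (Kfun_add N0_ge0 N1_ge0 hq0 hq1 (expR_gt0 _) _ _)).
apply: (@le_trans _ _ (eE cq * (eE (Num.max c0 c1 + t0 * n%:~R - C0 n%:~R) *
    (Y0 g0 + eE (P n%:~R) * Y1 g1)))); last first.
  by rewrite eE_mul eE_homo ?adde_ge0 ?eE_mul_ge0//; lra.
apply: eE_le; rewrite ge0_muleDr ?eE_mul_ge0// eE_mul; apply: leeD.
  have := h0 g0 n => /(eE_le (t0 * n%:~R - C0 n%:~R)); rewrite !eE_mul.
  have -> : (t0 * n%:~R - C0 n%:~R + (- t0 * n%:~R + C0 n%:~R) = 0)%R by ring.
  rewrite eE0 => /le_trans; apply; apply: eE_homo => //.
  have : (c0 <= Num.max c0 c1)%R by rewrite le_max lexx.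
  lra.
have := h1 g1 n => /(eE_le (t1 * n%:~R - C1 n%:~R)); rewrite !eE_mul.
have -> : (t1 * n%:~R - C1 n%:~R + (- t1 * n%:~R + C1 n%:~R) = 0)%R by ring.
rewrite eE0 => /le_trans; apply; apply: eE_homo => //.
have : (c1 <= Num.max c0 c1)%R by rewrite le_max lexx orbT.
rewrite /P /d; lra.
Qed.

(** Each hypothesis on e is a decay rate required by an upper bound. For f0 the rates are eta - t0 -
    2e when k <= n and t0 when k >= n; for f1 they are 1 - t1 and t1 - eta - 2e. The loss 2e comes
    from the damping in the hypothesis and the variation of [S]. *)
Lemma reiteration_upper (e : R) : (0 < e)%R -> (3 * e <= eta - t0)%R ->
    (3 * e <= t1 - eta)%R -> (e <= t0)%R -> (e <= 1 - t1)%R ->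
  exists c : R, forall f (n : int) (B : \bar R), kap n f < +oo -> 0 <= B ->
    (forall k : int, weightedK eta S N0 N1 f k%:~R <= eE (e * `|(n - k)%:~R|) * B) ->
  weightedK th A Y0 Y1 f (P n%:~R) <= eE c * B.
Proof.
move=> e0 e1 e2 e3 e4.
have [cd hcd] := Kfun_decomposition hm hN.
have [c0 h0] := up0 e0; have [c1 h1] := up1 e0.
have [cS hcS] := sv_S e0.
pose cm := Num.max c0 c1.
exists (`|cd| + cS + cm + 1)%R => f n B fn B0 hB.
(* A finite [B] is needed below to place the pieces in Y0 and Y1. *)
have [By|By] := eqVneq B +oo.
  by rewrite By gt0_muley ?leey// lte_fin expR_gt0.
have hk (k : int) : kap k f <=
    eE (cS + eta * k%:~R - S n%:~R + 2 * e * `|(k - n)%:~R|) * B.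
  have := hB k; rewrite /weightedK -/(kap k f) => /(eE_le (eta * k%:~R - S k%:~R)).
  rewrite !eE_mul.
  have -> : (eta * k%:~R - S k%:~R + (- eta * k%:~R + S k%:~R) = 0)%R by ring.
  rewrite eE0 => /le_trans; apply; apply: eE_homo => //.
  have -> : (`|(n - k)%:~R| = `|(k - n)%:~R| :> R)%R by rewrite !intrB distrC.
  have := hcS n%:~R k%:~R; have := ler_norm (S n%:~R - S k%:~R).
  by rewrite [X in (_ <= _ + _ * X)%R -> _]distrC -!intrB; lra.
have [f0 [f1 [fE hf]]] := hcd n f fn.
pose D := (`|cd| + cS + (eta - t0) * n%:~R - S n%:~R + C0 n%:~R)%R.
pose D' := (`|cd| + cS + (eta - t1) * n%:~R - S n%:~R + C1 n%:~R)%R.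
have cdn := ler_norm cd.
have hn : kap n f <= eE (cS + eta * n%:~R - S n%:~R) * B.
  by have := hk n; rewrite subrr normr0 mulr0 addr0.
have Yf0 : Y0 f0 <= eE c0 * (eE D * B).
  apply: (h0 _ n); first by rewrite eE_mul_ge0.
  move=> k; rewrite eE_mul; case: (leP k n) => [kn|/ltW kn].
    have [+ _] := hf k; move/(_ kn) => [+ _] => /le_trans; apply.
    apply: (le_trans (eE_le _ (hk k))); rewrite eE_mul; apply: eE_homo => //.
    have knR : (k%:~R <= n%:~R :> R)%R by rewrite ler_int.
    have -> : (`|(k - n)%:~R| = n%:~R - k%:~R :> R)%R.
      by rewrite intrB distrC ger0_norm// subr_ge0.
    by rewrite /D; nra.
  have [_ +] := hf k; move/(_ kn) => [+ _] => /le_trans; apply.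
  apply: (le_trans (eE_le _ hn)); rewrite eE_mul; apply: eE_homo => //.
  have knR : (n%:~R <= k%:~R :> R)%R by rewrite ler_int.
  have -> : (`|(k - n)%:~R| = k%:~R - n%:~R :> R)%R.
    by rewrite intrB ger0_norm// subr_ge0.
  by rewrite /D; nra.
have Yf1 : Y1 f1 <= eE c1 * (eE D' * B).
  apply: (h1 _ n); first by rewrite eE_mul_ge0.
  move=> k; rewrite eE_mul; case: (leP k n) => [kn|/ltW kn].
    have [+ _] := hf k; move/(_ kn) => [_ +] => /le_trans; apply.
    apply: (le_trans (eE_le _ hn)); rewrite eE_mul; apply: eE_homo => //.
    have knR : (k%:~R <= n%:~R :> R)%R by rewrite ler_int.
    have -> : (`|(k - n)%:~R| = n%:~R - k%:~R :> R)%R.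
      by rewrite intrB distrC ger0_norm// subr_ge0.
    by rewrite /D'; nra.
  have [_ +] := hf k; move/(_ kn) => [_ +] => /le_trans; apply.
  apply: (le_trans (eE_le _ (hk k))); rewrite eE_mul; apply: eE_homo => //.
  have knR : (n%:~R <= k%:~R :> R)%R by rewrite ler_int.
  have -> : (`|(k - n)%:~R| = k%:~R - n%:~R :> R)%R.
    by rewrite intrB ger0_norm// subr_ge0.
  by rewrite /D'; nra.
have cY0 : carrier Y0 f0.
  by apply: (le_lt_trans Yf0); rewrite eE_mul lte_mul_pinfty ?eE_ge0// ltey.
have cY1 : carrier Y1 f1.
  by apply: (le_lt_trans Yf1); rewrite eE_mul lte_mul_pinfty ?eE_ge0// ltey.
rewrite /weightedK fE.
apply: (le_trans (eE_le _ (Kfun_le (expR (P n%:~R)) cY0 cY1))).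
apply: (le_trans (eE_le _ (leeD Yf0 (eE_le _ Yf1)))).
have m0 : (c0 <= cm)%R by rewrite le_max lexx.
have m1 : (c1 <= cm)%R by rewrite le_max lexx orbT.
rewrite !eE_mul ge0_muleDr ?eE_mul_ge0// !eE_mul.
have -> : (`|cd| + cS + cm + 1 = 1 + (`|cd| + cS + cm))%R by ring.
(* By the choice of eta and [S], all terms depending on [n] cancel in both exponents; the extra 1
   pays for 2 <= e. *)
apply: (@le_trans _ _ (eE (`|cd| + cS + cm) * B + eE (`|cd| + cS + cm) * B)).
  apply: leeD; apply: eE_homo => //.
    by rewrite /D /S /P /eta /d; lra.
  by rewrite /D' /S /P /eta /d; lra.
by have := adde_self_le (eE_mul_ge0 (`|cd| + cS + cm) B0); rewrite eE_mul.
Qed.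

Lemma cont_embedded_eE (N M : V -> \bar R) :
  (exists c : R, forall f, carrier N f -> M f <= eE c * N f) -> cont_embedded N M.
Proof.
move=> [c hc]; split=> [f Nf|]; last by exists (expR c) => //; exact: expR_gt0.
by apply: (le_lt_trans (hc f Nf)); rewrite lte_mul_pinfty ?eE_ge0.
Qed.

Variables (r : \bar R) (a b : R -> R).
Hypotheses (r0 : 0 < r) (a0 : forall t, (0 < t)%R -> (0 < a t)%R)
  (b0 : forall t, (0 < t)%R -> (0 < b t)%R).
Hypotheses (lga : lg a = A) (lgb : lg b = S).

(** After multiplication by the weight at e^n, [reiteration_lower] bounds by the weighted
    K-functional of (Y0, Y1) at rho(e^n) exactly; only the passage to the points e^j remains. *)
Lemma interp_reiteration_sub :
  cont_embedded (interp th r a Y0 Y1) (interp eta r b N0 N1).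
Proof.
apply: cont_embedded_eE.
have lipa : coarse_lip 1 (lg a) by rewrite lga; exact: svA.
have lipb : coarse_lip 1 (lg b) by rewrite lgb; exact: sv_S.
have [c1 hc1] := interp_discrete eta r0 b0 lipb.
have [c2 hc2] := interp_discrete th r0 a0 lipa.
have [c3 hc3] := reiteration_lower.
have [c4 hc4] := weightedK_lip 1 th lipa.
have [c5 [_ [_ hc5]]] := growth_sep d_gt0 svC01.
have [c6 hc6] := lq_schur r0 (divr_gt0 d_gt0 (@ltr0Sn R 1)) ltr01 hc5.
exists (c1 + ((c3 + c4 + 1) + (c6 + c2)))%R => f _.
have [h1 _] := hc1 V _ _ N0_ge0 N1_ge0 f.
have [_ h2] := hc2 V _ _ Y0_ge0 Y1_ge0 f.
have I0 : 0 <= interp th r a Y0 Y1 f by exact: LqOn_ge0.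
apply: (le_trans h1); rewrite -eE_mul; apply: eE_le.
pose phi (j : int) := weightedK th (lg a) Y0 Y1 f j%:~R.
have phi0 j : 0 <= phi j by exact: weightedK_ge0.
have phi0' (n j : int) : 0 <= eE (- 1 * `|P n%:~R - j%:~R|) * phi j.
  by rewrite eE_mul_ge0.
(* The value at the floor of [P n] is one term of a damped norm centred at [P n]. Several [n] may
   share a floor, and the Schur estimate controls this multiplicity. *)
apply: (@le_trans _ _ (eE (c3 + c4 + 1) *
    lq r (fun n => lq r (fun j => eE (- 1 * `|P n%:~R - j%:~R|) * phi j)))); last first.
  rewrite -(eE_mul (c3 + c4 + 1)); apply: eE_le; apply: (le_trans (hc6 phi phi0)).
  by rewrite -eE_mul; apply: eE_le.
apply: le_lq => // [n|n|n].
- exact: weightedK_ge0.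
- exact: lq_ge0.
have := lq_ub (Num.floor (P n%:~R)) r0 (phi0' n); rewrite /= => h3.
have h4 := floor_dist (P n%:~R).
have h5 := hc4 V _ _ Y0_ge0 Y1_ge0 f _ _ h4.
apply: le_trans (eE_le (c3 + c4 + 1) h3).
have h6 := eE_le (- eta * n%:~R + lg b n%:~R) (hc3 f n); rewrite /weightedK.
apply: (le_trans h6); rewrite eE_mul.
apply: (@le_trans _ _ (eE c3 * weightedK th (lg a) Y0 Y1 f (P n%:~R))).
  rewrite /weightedK eE_mul; apply: eE_homo; first by rewrite Kfun_ge0// expR_ge0.
  by rewrite lga lgb /S /P /eta /d; lra.
apply: (le_trans (eE_le c3 h5)); rewrite (eE_mul c3 c4) (eE_mul (c3 + c4 + 1)).
by apply: eE_homo; [exact: phi0|lra].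
Qed.

Lemma interp_reiteration_sup :
  cont_embedded (interp eta r b N0 N1) (interp th r a Y0 Y1).
Proof.
apply: cont_embedded_eE.
have lipa : coarse_lip 1 (lg a) by rewrite lga; exact: svA.
have lipb : coarse_lip 1 (lg b) by rewrite lgb; exact: sv_S.
have [th_gt0 th_lt1] := andP th01.
have eta0 : (0 < eta - t0)%R.
  by rewrite (_ : eta - t0 = th * d)%R ?mulr_gt0// /eta /d; ring.
have eta1 : (0 < t1 - eta)%R.
  rewrite (_ : t1 - eta = (1 - th) * d)%R ?mulr_gt0 ?subr_gt0// /eta /d; ring.
(* The largest rate allowed by the four constraints of [reiteration_upper]. *)
pose e := Num.min (Num.min ((eta - t0) / 3) ((t1 - eta) / 3))%R (Num.min t0 (1 - t1))%R.
have e0 : (0 < e)%R by rewrite !lt_min t0_gt0 subr_gt0 t1_lt1 !divr_gt0.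
have e1 : (3 * e <= eta - t0)%R.
  have : (e <= (eta - t0) / 3)%R by rewrite !ge_min lexx.
  lra.
have e2 : (3 * e <= t1 - eta)%R.
  have : (e <= (t1 - eta) / 3)%R by rewrite !ge_min lexx orbT.
  lra.
have e3 : (e <= t0)%R by rewrite !ge_min lexx !orbT.
have e4 : (e <= 1 - t1)%R by rewrite !ge_min lexx !orbT.
have [c1 hc1] := interp_discrete eta r0 b0 lipb.
have [c2 hc2] := interp_discrete th r0 a0 lipa.
have [c3 hc3] := reiteration_upper e0 e1 e2 e3 e4.
have [c4 hc4] := growth_inverse d_gt0 svC01.
have [c5 hc5] := weightedK_lip c4 th lipa.
have [c6 [c6_0 hc6]] := growth_lip d_gt0 svC01.
(* Each e^j is within a bounded factor of rho(e^(nu j)), where [reiteration_upper] applies. *)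
have [nu hnu] : exists nu : int -> int,
    forall j : int, (`|P (nu j)%:~R - j%:~R| <= c4)%R.
  by have [nu hnu] := choice (fun j : int => hc4 j%:~R); exists nu.
have d10 : (0 < d + 1)%R by rewrite addr_gt0// d_gt0.
have d1 : (0 < (d + 1)^-1)%R by rewrite invr_gt0.
(* Since [P] grows at rate at most d + 1, preimages of distant integers are distant, so [nu] is
   sparse enough for the Schur estimate. *)
have sep (i j : int) : ((d + 1)^-1 * `|(i - j)%:~R| - (d + 1)^-1 * (c6 + 2 * c4)
    <= `|(nu i)%:~R - (nu j)%:~R|)%R.
  rewrite -mulrBr mulrC ler_pdivrMr ?d10//.
  have h1 := hnu i; have h2 := hnu j; have h3 := hc6 (nu i)%:~R (nu j)%:~R.
  have h4 : (`|(i - j)%:~R| <= `|P (nu i)%:~R - i%:~R| + `|P (nu j)%:~R - j%:~R|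
     + `|P (nu i)%:~R - P (nu j)%:~R| :> R)%R.
    have -> : ((i - j)%:~R = - (P (nu i)%:~R - i%:~R) + (P (nu j)%:~R - j%:~R)
     + (P (nu i)%:~R - P (nu j)%:~R) :> R)%R by rewrite intrB; ring.
    apply: (le_trans (ler_normD _ _)); rewrite lerD2r.
    by apply: (le_trans (ler_normD _ _)); rewrite normrN.
  rewrite [X in (_ <= X)%R]mulrC; rewrite -/P in h3.
  lra.
have [c7 hc7] := lq_schur r0 d1 e0 sep.
exists (c2 + ((c5 + c3) + (c7 + c1)))%R => f If.
have [_ h1] := hc1 V _ _ N0_ge0 N1_ge0 f.
have [h2 _] := hc2 V _ _ Y0_ge0 Y1_ge0 f.
have I0 : 0 <= interp eta r b N0 N1 f by exact: LqOn_ge0.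
apply: (le_trans h2); rewrite -eE_mul; apply: eE_le.
pose y (k : int) := weightedK eta (lg b) N0 N1 f k%:~R.
have y0 k : 0 <= y k by exact: weightedK_ge0.
have y0' (n k : int) : 0 <= eE (- e * `|n%:~R - k%:~R|) * y k by rewrite eE_mul_ge0.
(* Membership in the right-hand space gives the finiteness required for decomposing f. *)
have kfin n : kap n f < +oo.
  have yfin : y n < +oo.
    apply: (le_lt_trans (lq_ub n r0 y0)); apply: (le_lt_trans h1).
    by rewrite lte_mul_pinfty ?eE_ge0.
  have : kap n f <= eE (- (- eta * n%:~R + lg b n%:~R)) * y n.
    by rewrite /y /weightedK eE_mul addNr eE0.
  by move=> /le_lt_trans; apply; rewrite lte_mul_pinfty ?eE_ge0.
(* Each term of this norm is at most the whole, which is exactly the hypothesis on [B] in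
   [reiteration_upper]. *)
pose B (n : int) := lq r (fun k => eE (- e * `|n%:~R - k%:~R|) * y k).
have B0 n : 0 <= B n by exact: lq_ge0.
have hB (n k : int) : weightedK eta S N0 N1 f k%:~R <= eE (e * `|(n - k)%:~R|) * B n.
  apply: eE_moveR; rewrite -mulNr intrB -lgb.
  exact: (lq_ub k r0 (y0' n)).
apply: (@le_trans _ _ (eE (c5 + c3) * lq r (fun j => B (nu j)))); last first.
  rewrite -(eE_mul (c5 + c3)); apply: eE_le; apply: (le_trans (hc7 y y0)).
  by rewrite -eE_mul; apply: eE_le.
apply: le_lq => // j; first exact: weightedK_ge0.
have h3 := hc3 f (nu j) (B (nu j)) (kfin _) (B0 _) (hB _).
have h4 := hnu j; rewrite distrC in h4.
apply: (le_trans (hc5 V _ _ Y0_ge0 Y1_ge0 f _ _ h4)).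
by rewrite -eE_mul; apply: eE_le; rewrite lga.
Qed.

End reiteration.

(* Assembly in logarithmic coordinates *)
Local Close Scope ereal_scope.
Theorem theorem28 (R : realType) (K : numFieldType) (m : K -> R)
    (hm : modulus m) (V : topologicalLmodType K) (A0 A1 : V -> \bar R)
    (hA : compatible_couple m A0 A1)
    (hA01 : exists2 f : V, f != 0 & carrier A0 f /\ carrier A1 f)
    (theta0 theta1 theta : R) (r r0 r1 q0 q1 : \bar R)
    (a a0 a1 b0 b1 : R -> R)
    (htheta0 : 0 < theta0) (htheta01 : theta0 < theta1) (htheta1 : theta1 < 1)
    (htheta : 0 < theta < 1)
    (hr : (0 < r)%E) (hr0 : (0 < r0)%E) (hr1 : (0 < r1)%E)
    (hq0 : (0 < q0)%E) (hq1 : (0 < q1)%E)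
    (ha : slowly_varying a) (ha0 : slowly_varying a0) (ha1 : slowly_varying a1)
    (hb0 : slowly_varying b0) (hb1 : slowly_varying b1)
    (hw0 : (weight_norm r0 b0 a0 `]0%R, 1%R[ < +oo)%E)
    (hw1 : (weight_norm r1 b1 a1 `]1%R, +oo[ < +oo)%E) :
  let c0 := fun t : R => a0 t * fine (weight_norm r0 b0 a0 `]0, t[) in
  let c1 := fun t : R => a1 t * fine (weight_norm r1 b1 a1 `]t, +oo[) in
  let rho := fun t : R => t `^ (theta1 - theta0) * (c0 t / c1 t) in
  let eta := (1 - theta) * theta0 + theta * theta1 in
  let asharp := fun t : R =>
    c0 t `^ (1 - theta) * c1 t `^ theta * a (rho t) in
  space_equiv
    (interp theta r a (interpR theta0 r0 b0 q0 a0 A0 A1)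
                      (interpL theta1 r1 b1 q1 a1 A0 A1))
    (interp eta r asharp A0 A1).
Proof.
move=> c0 c1 rho eta asharp.
have [hm0 hN0 hN1] := hA.
have A0_ge0 f : (0 <= A0 f)%E by case: hN0 => [[h _ _ _] _ _]; exact: h.
have A1_ge0 f : (0 <= A1 f)%E by case: hN1 => [[h _ _ _] _ _]; exact: h.
have p0 : forall t, 0 < t -> 0 < a0 t by case: ha0.
have p1 : forall t, 0 < t -> 0 < a1 t by case: ha1.
have p : forall t, 0 < t -> 0 < a t by case: ha.
pose C0 (x : R) := lg a0 x + log_ray_weight true r0 a0 b0 x.
pose C1 (x : R) := lg a1 x + log_ray_weight false r1 a1 b1 x.
(* The rays opposite to those of the R- and L-norms at 1 are (0, 1) and (1, oo), so the two weight
   hypotheses apply by conversion. *)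
have W0 : (ray_weight true r0 a0 b0 1 < +oo)%E by exact: hw0.
have W1 : (ray_weight false r1 a1 b1 1 < +oo)%E by exact: hw1.
have svC0 : sv C0 by exact: sv_cumulative.
have svC1 : sv C1 by exact: sv_cumulative.
(* Taking [fine] loses nothing: the cumulative norm is finite and positive at every t > 0. *)
have c0E x : c0 (expR x) = expR (C0 x).
  have [_ w0] := ray_weight_fin hr0 ha0 hb0 W0 (expR_gt0 x).
  by rewrite expRD /lg lnK ?posrE ?p0 ?expR_gt0// /log_ray_weight lnK ?posrE.
have c1E x : c1 (expR x) = expR (C1 x).
  have [_ w1] := ray_weight_fin hr1 ha1 hb1 W1 (expR_gt0 x).
  by rewrite expRD /lg lnK ?posrE ?p1 ?expR_gt0// /log_ray_weight lnK ?posrE.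
pose P (x : R) := (theta1 - theta0) * x + (C0 x - C1 x).
have rhoE x : rho (expR x) = expR (P x).
  by rewrite /rho c0E c1E -expRM -expRN -!expRD; congr expR; rewrite /P; ring.
have asharpE x : asharp (expR x) =
    expR ((1 - theta) * C0 x + theta * C1 x + lg a (P x)).
  have aE : a (expR (P x)) = expR (lg a (P x)) by rewrite /lg lnK ?posrE ?p ?expR_gt0.
  by rewrite /asharp c0E c1E rhoE aE -!expRM -!expRD; congr expR; ring.
have psharp t : 0 < t -> 0 < asharp t.
  by move=> t0; rewrite -(lnK (x := t)) ?posrE// asharpE expR_gt0.
have lgsharp : lg asharp = fun x => (1 - theta) * C0 x + theta * C1 x + lg a (P x).
  by apply/funext => x; rewrite /lg asharpE expRK.
have Y0_ge0 f : (0 <= interpR theta0 r0 b0 q0 a0 A0 A1 f)%E by exact: LqOn_ge0.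
have Y1_ge0 f : (0 <= interpL theta1 r1 b1 q1 a1 A0 A1 f)%E by exact: LqOn_ge0.
(* The R- and L-norms are the cases [true] and [false] of [interpRay] by conversion. *)
have low0 : lower_bound A0 A1 (interpR theta0 r0 b0 q0 a0 A0 A1) theta0 C0.
  have [c hc] := interpRay_lower hr0 ha0 hb0 W0 theta0 hq0.
  by exists c => f n; exact: hc.
have low1 : lower_bound A0 A1 (interpL theta1 r1 b1 q1 a1 A0 A1) theta1 C1.
  have [c hc] := interpRay_lower hr1 ha1 hb1 W1 theta1 hq1.
  by exists c => f n; exact: hc.
have up0 : upper_bound A0 A1 (interpR theta0 r0 b0 q0 a0 A0 A1) theta0 C0.
  move=> e e0; have [c hc] := interpRay_upper hr0 ha0 hb0 W0 theta0 hq0 e0.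
  by exists c => f n; exact: hc.
have up1 : upper_bound A0 A1 (interpL theta1 r1 b1 q1 a1 A0 A1) theta1 C1.
  move=> e e0; have [c hc] := interpRay_upper hr1 ha1 hb1 W1 theta1 hq1 e0.
  by exists c => f n; exact: hc.
split.
  exact: (interp_reiteration_sub hA htheta01 Y0_ge0 Y1_ge0 svC0 svC1 (sv_lg ha)
    low0 low1 hr p psharp erefl lgsharp).
exact: (interp_reiteration_sup hm hA htheta0 htheta01 htheta1 htheta Y0_ge0 Y1_ge0
  svC0 svC1 (sv_lg ha) up0 up1 hr p psharp erefl lgsharp).
Qed.
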